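(* For every $n\ge 4$ the family $\mathcal{S}_n$ is generic in the variety of all $n$-dimensional complex commutative nilpotent algebras. Moreover, for every $n\ge 2$ this variety is irreducible and has dimension $\frac{n(n-1)(n+4)}{6}$.
   Context: All algebras are over $\mathbb{C}$, not necessarily associative. Fix an $n$-dimensional vector space with basis $e_1,\dots,e_n$; algebra structures are identified with points $(c_{ij}^k)\in\mathbb{C}^{n^3}$ of structure constants, $e_ie_j=\sum_k c_{ij}^ke_k$, with Zariski topology; $\mathrm{GL}_n(\mathbb{C})$ acts by change of basis and $O(\mathcal{A})$ denotes an orbit. An algebra $N$ is nilpotent if $N^k=0$ for some $k$, where $N^1=N$, $N^{k+1}=\sum_{i=1}^kN^iN^{k+1-i}$. A family $\mathcal{R}$ in an irreducible variety $\mathfrak{V}$ is generic if $\overline{\bigcup_{\mathcal{A}\in\mathcal{R}}O(\mathcal{A})}=\mathfrak{V}$. Condition ( * ): $c_{ij}^k=0$ whenever $k\le\max\{i,j\}$. For $n\ge4$, $\mathcal{S}_n$ is the family of commutative algebra structures satisfying ( * ) such that $e_i^2=e_{i+1}$ for $1\le i\le n-1$, $c_{23}^4=1$, $c_{12}^4\ne 0$, $c_{1i}^{i+1}=0$ for $2\le i\le n-1$, with all other structure constants arbitrary subject only to ( * ) and commutativity. *)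

(* Defs.v *)
(* The base field is the complex numbers, realised as R[i]
   for an arbitrary R : realType (every realType is a model of the reals). *)
From HB Require Import structures.
From mathcomp Require Import all_boot all_order all_algebra.
From mathcomp Require Import reals complex.
Set Implicit Arguments. Unset Strict Implicit. Unset Printing Implicit Defensive.
Import Order.TTheory GRing.Theory Num.Theory.
Local Open Scope ring_scope.

Section AlgebraVariety.
Variable F : fieldType.
Variable n : nat.

(* A point of F^(n^3): structure constants c i j k = c_{ij}^k,
   e_i e_j = \sum_k c_{ij}^k e_k  (indices 0-based). *)
Definition sconst := 'I_n -> 'I_n -> 'I_n -> F.

Inductive is_polyfun : (sconst -> F) -> Prop :=
| pf_const (a : F) : is_polyfun (fun _ => a)
| pf_coord (i j k : 'I_n) : is_polyfun (fun c => c i j k)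
| pf_add f g : is_polyfun f -> is_polyfun g -> is_polyfun (fun c => f c + g c)
| pf_mul f g : is_polyfun f -> is_polyfun g -> is_polyfun (fun c => f c * g c).

Definition zclosed (Z : sconst -> Prop) : Prop :=
  exists Ps : (sconst -> F) -> Prop,
    (forall p, Ps p -> is_polyfun p) /\
    (forall c, Z c <-> (forall p, Ps p -> p c = 0)).

Definition subset (A B : sconst -> Prop) := forall c, A c -> B c.
Definition seteq (A B : sconst -> Prop) := forall c, A c <-> B c.

Definition zclosure (S : sconst -> Prop) : sconst -> Prop :=
  fun c => forall Z, zclosed Z -> subset S Z -> Z c.

Definition irreducible (V : sconst -> Prop) : Prop :=
  (exists c, V c) /\
  forall Z1 Z2, zclosed Z1 -> zclosed Z2 ->
    subset V (fun c => Z1 c \/ Z2 c) -> subset V Z1 \/ subset V Z2.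

Definition has_chain (V : sconst -> Prop) (d : nat) : Prop :=
  exists Z : nat -> sconst -> Prop,
    (forall i, (i <= d)%N -> zclosed (Z i) /\ irreducible (Z i) /\ subset (Z i) V) /\
    (forall i, (i < d)%N -> subset (Z i) (Z i.+1) /\ ~ subset (Z i.+1) (Z i)).

Definition zdim_eq (V : sconst -> Prop) (D : nat) : Prop :=
  has_chain V D /\ ~ has_chain V D.+1.

Definition vec := 'I_n -> F.

Definition amul (c : sconst) (x y : vec) : vec :=
  fun k => \sum_(i < n) \sum_(j < n) x i * y j * c i j k.

Definition commutative_sc (c : sconst) : Prop :=
  forall i j k, c i j k = c j i k.

(* inpow c k x  <->  x \in N^k, where N^1 = N and
   N^(k) = sum_{i=1}^{k-1} N^i N^(k-i) (span of products) *)
Inductive inpow (c : sconst) : nat -> vec -> Prop :=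
| ip_one x : inpow c 1 x
| ip_zero k : (0 < k)%N -> inpow c k (fun _ => 0)
| ip_prod k i x y : (0 < i)%N -> (i < k)%N ->
    inpow c i x -> inpow c (k - i) y -> inpow c k (amul c x y)
| ip_add k x y : inpow c k x -> inpow c k y -> inpow c k (fun l => x l + y l)
| ip_scale k a x : inpow c k x -> inpow c k (fun l => a * x l).

Definition nilpotent_sc (c : sconst) : Prop :=
  exists k, (0 < k)%N /\ forall x, inpow c k x -> forall l, x l = 0.

Definition comm_nilp (c : sconst) : Prop := commutative_sc c /\ nilpotent_sc c.

(* new basis e'_i = \sum_a g a i e_a *)
Definition act (g : 'M[F]_n) (c : sconst) : sconst :=
  fun i j k => \sum_(a < n) \sum_(b < n) \sum_(l < n)
                 g a i * g b j * c a b l * invmx g k l.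

Definition orbit (c : sconst) : sconst -> Prop :=
  fun c' => exists2 g : 'M[F]_n, g \in unitmx & forall i j k, c' i j k = act g c i j k.

Definition generic (Rf V : sconst -> Prop) : Prop :=
  seteq (zclosure (fun c => exists2 a, Rf a & orbit a c)) V.

(* ---------- the family S_n (1-based indices of the paper shifted by one) *)
Definition condStar (c : sconst) : Prop :=
  forall i j k : 'I_n, (k <= maxn i j)%N -> c i j k = 0.

Definition familyS (c : sconst) : Prop :=
  commutative_sc c /\ condStar c /\
  (forall i k : 'I_n, (i.+1 < n)%N -> c i i k = (k == i.+1 :> nat)%:R) /\
  (forall i j k : 'I_n, i = 1%N :> nat -> j = 2%N :> nat -> k = 3%N :> nat ->
     c i j k = 1) /\
  (forall i j k : 'I_n, i = 0%N :> nat -> j = 1%N :> nat -> k = 3%N :> nat ->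
     c i j k != 0) /\
  (forall h i k : 'I_n, h = 0%N :> nat -> (1 <= i)%N -> k = i.+1 :> nat ->
     c h i k = 0).

End AlgebraVariety.

(* Main.v *)
Require Import Defs.
From HB Require Import structures.
From mathcomp Require Import all_boot all_order all_algebra.
From mathcomp Require Import reals complex boolp ring zify.
Set Implicit Arguments. Unset Strict Implicit. Unset Printing Implicit Defensive.
Import Defs Order.TTheory GRing.Theory Num.Theory.
Local Open Scope ring_scope.

(* A nilpotent algebra has a basis adapted to the flag of its powers, in which ( * ) holds;
   so the variety V is GL_n . W, where W is the linear space of commutative structures
   satisfying ( * ).  As W is stable under lower triangular changes of basis and a generic
   matrix is a product LU, V is the closure of the image of a polynomial map phi from the
   affine space U x W, with U the upper unitriangular matrices; its dimension is
   n(n-1)/2 + (n+1)n(n-1)/6.  Everything "generic" is checked on lines: a polynomial in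
   one variable that vanishes off the zeros of a nonzero one is zero.

   Upper bound on the dimension: a chain of length d yields, for every m, m^d functions
   of degree O(m) linearly independent on V, while polynomials of degree O(m) in D
   variables span a space of dimension O(m^D).  Lower bound: the closures of the images
   of the coordinate subspaces of U x W form a chain, if the coordinates are ordered well.

   For the family S_n, a basis of a generic algebra of W is normalised by e_(i+1) = e_i^2;
   it only depends on e_1, whose coordinates are found one by one from
   c_(1i)^(i+1) = 0, up to a factor that is a square root imposed by c_23^4 = 1. *)

(** * Zariski topology and polynomial curves *)

(** One interface serves three notions: polynomial functions of the structure constants, functions
    polynomial along a curve, and polynomials in the parameters. Determinants and adjugates then
    stay polynomial in all three senses. *)
Record function_ring (F : fieldType) (X : Type) (P : (X -> F) -> Prop) : Prop :=
  FunctionRing {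
    fr_cst : forall a, P (fun=> a);
    fr_add : forall f g, P f -> P g -> P (fun x => f x + g x);
    fr_mul : forall f g, P f -> P g -> P (fun x => f x * g x) }.

Section FunctionRing.
Variables (F : fieldType) (X : Type) (P : (X -> F) -> Prop).
Hypothesis ringP : function_ring P.

Lemma fr_opp f : P f -> P (fun x => - f x).
Proof.
move=> Pf; have := fr_mul ringP (fr_cst ringP (-1)) Pf.
by congr P; apply: funext => x; rewrite mulN1r.
Qed.

Lemma fr_sub f g : P f -> P g -> P (fun x => f x - g x).
Proof. by move=> Pf /fr_opp; apply: fr_add. Qed.

Lemma fr_sum (I : Type) (r : seq I) (Q : pred I) (f : I -> X -> F) :
  (forall i, Q i -> P (f i)) -> P (fun x => \sum_(i <- r | Q i) f i x).
Proof.
move=> Pf; elim: r => [|i r IHr].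
  by have := fr_cst ringP 0; congr P; apply: funext => x; rewrite big_nil.
have [Qi|nQi] := boolP (Q i).
  have := fr_add ringP (Pf i Qi) IHr.
  by congr P; apply: funext => x; rewrite big_cons Qi.
by move: IHr; congr P; apply: funext => x; rewrite big_cons (negbTE nQi).
Qed.

Lemma fr_prod (I : Type) (r : seq I) (f : I -> X -> F) :
  (forall i, P (f i)) -> P (fun x => \prod_(i <- r) f i x).
Proof.
move=> Pf; elim: r => [|i r IHr].
  by have := fr_cst ringP 1; congr P; apply: funext => x; rewrite big_nil.
have := fr_mul ringP (Pf i) IHr.
by congr P; apply: funext => x; rewrite big_cons.
Qed.

Lemma fr_exp f k : P f -> P (fun x => f x ^+ k).
Proof.
move=> Pf; elim: k => [|k IHk].
  by have := fr_cst ringP 1; congr P; apply: funext => x; rewrite expr0.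
have := fr_mul ringP Pf IHk.
by congr P; apply: funext => x; rewrite exprS.
Qed.

Lemma fr_det n (A : X -> 'M[F]_n) :
  (forall i j, P (fun x => A x i j)) -> P (fun x => \det (A x)).
Proof.
move=> PA; apply: fr_sum => s _; apply: (fr_mul ringP) => //.
  exact: fr_cst.
exact: fr_prod.
Qed.

Lemma fr_adj n (A : X -> 'M[F]_n) :
  (forall i j, P (fun x => A x i j)) -> forall i j, P (fun x => (\adj (A x)) i j).
Proof.
move=> PA i j.
have -> : (fun x => (\adj (A x)) i j)
    = (fun x => (-1) ^+ (j + i) * \det (row' j (col' i (A x)))).
  by apply: funext => x; rewrite mxE.
apply: (fr_mul ringP); first exact: fr_cst.
apply: fr_det => k l; have := PA (lift j k) (lift i l).
by congr P; apply: funext => x; rewrite !mxE.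
Qed.

Lemma fr_polyfun n (c : X -> sconst F n) (p : sconst F n -> F) :
  (forall i j k, P (fun x => c x i j k)) -> is_polyfun p -> P (fun x => p (c x)).
Proof.
move=> Pc; elim=> {p} [a|i j k|f g _ Pf _ Pg|f g _ Pf _ Pg].
- exact: fr_cst.
- exact: Pc.
- exact: fr_add.
- exact: fr_mul.
Qed.

End FunctionRing.

Lemma polyfun_ring (F : fieldType) n : function_ring (@is_polyfun F n).
Proof. by split; [apply: pf_const | apply: pf_add | apply: pf_mul]. Qed.

Definition poly_curve (F : fieldType) (f : F -> F) :=
  exists p : {poly F}, forall t, f t = p.[t].

Lemma poly_curve_ring (F : fieldType) : function_ring (@poly_curve F).
Proof.
split=> [a|f g [p fp] [q gq]|f g [p fp] [q gq]].
- by exists a%:P => t; rewrite hornerC.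
- by exists (p + q) => t; rewrite hornerD fp gq.
- by exists (p * q) => t; rewrite hornerM fp gq.
Qed.

Lemma poly_curve_line (F : fieldType) (a b : F) :
  poly_curve (fun t => (1 - t) * a + t * b).
Proof.
by exists (a%:P + 'X * (b - a)%:P) => t; rewrite !hornerE; ring.
Qed.

(** The product of two nonzero polynomials is nonzero, so it has a non-root over an algebraically
    closed field. *)
Lemma poly_curve_avoid (F : closedFieldType) (f g : F -> F) a b :
  poly_curve f -> poly_curve g -> f a != 0 -> g b != 0 ->
  exists2 t, f t != 0 & g t != 0.
Proof.
move=> [p fp] [q gq]; rewrite fp gq => pa qb.
have pq0 : p * q != 0.
  by rewrite mulf_neq0 //; [apply: contraNneq pa|apply: contraNneq qb] => ->;
     rewrite horner0.
have /closed_nonrootP[t] := pq0.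
by rewrite rootM negb_or => /andP[pt qt]; exists t; rewrite ?fp ?gq.
Qed.

Lemma poly_curve_eq0 (F : closedFieldType) (f g : F -> F) b :
  poly_curve f -> poly_curve g -> g b != 0 ->
  (forall t, g t != 0 -> f t = 0) -> forall a, f a = 0.
Proof.
move=> fP gP gb fg a; apply/eqP; apply: contraTT isT => fa.
have [t ft gt] := poly_curve_avoid fP gP fa gb.
by rewrite (fg t gt) eqxx in ft.
Qed.

Section Zariski.
Variables (F : fieldType) (n : nat).
Implicit Types (S V Z : sconst F n -> Prop) (p : sconst F n -> F).

Lemma sconst_eqP (c c' : sconst F n) : (forall i j k, c i j k = c' i j k) -> c = c'.
Proof. by move=> E; do 3!(apply: funext => ?). Qed.

Lemma zclosed_zero p : is_polyfun p -> zclosed (fun c => p c = 0).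
Proof.
move=> Pp; exists (eq p); split=> [q <-//|c]; split=> [pc q <-//|]; exact.
Qed.

Lemma mem_zclosureP S c :
  zclosure S c <-> forall p, is_polyfun p -> (forall s, S s -> p s = 0) -> p c = 0.
Proof.
split=> [clc p Pp pS|pS Z [Ps [PsP ZP]] SZ].
  exact: (clc _ (zclosed_zero Pp)).
by apply/ZP => p Ppp; apply: pS => [|s /SZ /ZP]; [apply: PsP | apply].
Qed.

Lemma zclosed_zclosure S : zclosed (zclosure S).
Proof.
exists (fun p => is_polyfun p /\ forall s, S s -> p s = 0).
split=> [p []//|c]; rewrite mem_zclosureP.
by split=> [H p [Pp pS]|H p Pp pS]; apply: H.
Qed.

Lemma sub_zclosure S : subset S (zclosure S).
Proof. by move=> c Sc Z _; apply. Qed.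

Lemma zclosure_sub S Z : zclosed Z -> subset S Z -> subset (zclosure S) Z.
Proof. by move=> Zcl SZ c; apply. Qed.

Lemma zclosed_separate Z c : zclosed Z -> ~ Z c ->
  exists p, [/\ is_polyfun p, forall z, Z z -> p z = 0 & p c != 0].
Proof.
move=> [Ps [PsP ZP]] /ZP /existsNP[p] /not_implyP[Psp pc0]; exists p; split.
- exact: PsP.
- by move=> z /ZP; apply.
- exact/eqP.
Qed.

Lemma irreducible_mul Z p q : irreducible Z -> is_polyfun p -> is_polyfun q ->
  (forall c, Z c -> p c * q c = 0) ->
  (forall c, Z c -> p c = 0) \/ (forall c, Z c -> q c = 0).
Proof.
move=> [_ irrZ] Pp Pq pq0.
apply: (irrZ _ _ (zclosed_zero Pp) (zclosed_zero Pq)) => c /pq0 /eqP.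
by rewrite mulf_eq0 => /orP[] /eqP; [left | right].
Qed.

(** If [S] lay in neither [Z1] nor [Z2], the polynomials separating a point of [S] from each of them
    would be nonzero together at some point of [S], which is then outside both. *)
Lemma irreducible_zclosure S :
  (exists c, S c) ->
  (forall p q a b, is_polyfun p -> is_polyfun q -> S a -> S b ->
     p a != 0 -> q b != 0 -> exists c, [/\ S c, p c != 0 & q c != 0]) ->
  irreducible (zclosure S).
Proof.
move=> [c0 Sc0] S_pq; split; first by exists c0; apply: sub_zclosure.
move=> Z1 Z2 Z1cl Z2cl clS; apply: contrapT => /not_orP[/existsNP[a] H1 H2].
suff [c [Sc nZ1 nZ2]] : exists c, [/\ S c, ~ Z1 c & ~ Z2 c].
  by case: (clS c (sub_zclosure Sc)).
have [a1 Sa1 nZa1] : exists2 a, S a & ~ Z1 a.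
  apply: contrapT => nS1; apply: (iffLR (not_implyP _ _) H1).2.
  apply: (zclosure_sub Z1cl) => [s Ss|]; last exact: (iffLR (not_implyP _ _) H1).1.
  by apply: contrapT => nZ1s; apply: nS1; exists s.
have [a2 Sa2 nZa2] : exists2 a, S a & ~ Z2 a.
  apply: contrapT => nS2; apply: H2; apply: zclosure_sub => // s Ss.
  by apply: contrapT => nZ2s; apply: nS2; exists s.
have [p [Pp pZ pa]] := zclosed_separate Z1cl nZa1.
have [q [Pq qZ qa]] := zclosed_separate Z2cl nZa2.
have [c [Sc pc qc]] := S_pq _ _ _ _ Pp Pq Sa1 Sa2 pa qa.
by exists c; split=> // [/pZ|/qZ] c0E; [move: pc|move: qc]; rewrite c0E eqxx.
Qed.

Lemma seteq_eq S V : seteq S V -> S = V.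
Proof. by move=> SV; apply: funext => c; apply: propext. Qed.

End Zariski.

(** * Chains of irreducible sets and parametrizations *)

Section ParamPoly.
Variables (F : fieldType) (T : finType).
Implicit Types (f g : (T -> F) -> F) (N M : nat).

(** The degree is bounded in each variable separately, so that the bound [N] leaves [N.+1 ^ #|T|]
    monomials, indexed by a finite type. *)
Definition degree_le N f :=
  exists a : {ffun T -> 'I_N.+1} -> F,
    forall x, f x = \sum_al a al * \prod_i x i ^+ al i.

Lemma degree_le_add N f g :
  degree_le N f -> degree_le N g -> degree_le N (fun x => f x + g x).
Proof.
move=> [a fa] [b gb]; exists (fun al => a al + b al) => x.
by rewrite fa gb -big_split; apply: eq_bigr => al _; rewrite mulrDl.
Qed.

Lemma degree_le_scale N f a : degree_le N f -> degree_le N (fun x => a * f x).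
Proof.
move=> [b fb]; exists (fun al => a * b al) => x.
by rewrite fb mulr_sumr; apply: eq_bigr => al _; rewrite mulrA.
Qed.

Lemma degree_le_monomial N (be : T -> nat) :
  (forall i, (be i <= N)%N) -> degree_le N (fun x => \prod_i x i ^+ be i).
Proof.
move=> beN; pose be' := [ffun i => inord (be i) : 'I_N.+1].
exists (fun al => (al == be')%:R) => x.
rewrite (bigD1 be') //= eqxx mul1r [X in _ + X]big1 ?addr0 => [|al /negbTE->].
  by apply: eq_bigr => i _; rewrite ffunE inordK // ltnS.
by rewrite mul0r.
Qed.

Lemma degree_le_cst a : degree_le 0 (fun=> a).
Proof.
have := degree_le_scale a (@degree_le_monomial 0 (fun=> 0%N) (fun=> leqnn _)).
congr degree_le; apply: funext => x.
by rewrite big1 ?mulr1 // => i _; rewrite expr0.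
Qed.

Lemma degree_le_sum N (I : Type) (r : seq I) (h : I -> (T -> F) -> F) :
  (forall i, degree_le N (h i)) -> degree_le N (fun x => \sum_(i <- r) h i x).
Proof.
move=> hN; elim: r => [|i r IHr].
  exists (fun=> 0) => x; rewrite big_nil big1 // => al _; exact: mul0r.
have := degree_le_add (hN i) IHr.
by congr degree_le; apply: funext => x; rewrite big_cons.
Qed.

Lemma degree_le_mul N M f g :
  degree_le N f -> degree_le M g -> degree_le (N + M) (fun x => f x * g x).
Proof.
move=> [a fa] [b gb].
have -> : (fun x => f x * g x) = (fun x => \sum_al \sum_be
    a al * (b be * \prod_i x i ^+ (al i + be i))).
  apply: funext => x; rewrite fa gb big_distrlr /=; apply: eq_bigr => al _.
  apply: eq_bigr => be _; rewrite mulrACA -big_split /= -mulrA; congr (_ * (_ * _)).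
  by apply: eq_bigr => i _; rewrite exprD.
apply: degree_le_sum => al; apply: degree_le_sum => be.
do 2!apply: degree_le_scale; apply: degree_le_monomial => i.
by apply: leq_add; rewrite -ltnS.
Qed.

Lemma degree_le_widen N M f : (N <= M)%N -> degree_le N f -> degree_le M f.
Proof.
move=> leNM [a fa].
have -> : f = (fun x => \sum_al a al * \prod_i x i ^+ al i) by exact: funext.
apply: degree_le_sum => al; apply/degree_le_scale/degree_le_monomial => i.
by apply: leq_trans leNM; rewrite -ltnS.
Qed.

Lemma degree_le_exp N f k :
  degree_le N f -> degree_le (N * k) (fun x => f x ^+ k).
Proof.
move=> fN; elim: k => [|k IHk].
  by rewrite muln0; have := degree_le_cst 1; congr degree_le; apply: funext => x.
rewrite mulnS; have := degree_le_mul fN IHk.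
by congr degree_le; apply: funext => x; rewrite exprS.
Qed.

Definition param_poly f := exists N, degree_le N f.

Lemma param_poly_ring : function_ring param_poly.
Proof.
split=> [a|f g [N fN] [M gM]|f g [N fN] [M gM]].
- by exists 0%N; apply: degree_le_cst.
- exists (maxn N M); apply: degree_le_add.
    by apply: degree_le_widen fN; rewrite leq_maxl.
  by apply: degree_le_widen gM; rewrite leq_maxr.
- by exists (N + M)%N; apply: degree_le_mul.
Qed.

Lemma param_poly_coord i : param_poly (fun x => x i).
Proof.
exists 1%N; have := @degree_le_monomial 1 (fun j => (j == i)) (fun=> leq_b1 _).
congr degree_le; apply: funext => x.
rewrite (bigD1 i) //= eqxx expr1 big1 ?mulr1 // => j /negbTE->.
by rewrite expr0.
Qed.

Lemma param_poly_curve f (x : F -> T -> F) : param_poly f ->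
  (forall i, poly_curve (fun t => x t i)) -> poly_curve (fun t => f (x t)).
Proof.
move=> [N [a fa]] xP; have ringP := poly_curve_ring F.
have -> : (fun t => f (x t)) =
    (fun t => \sum_al a al * \prod_i x t i ^+ al i) by apply: funext.
apply: fr_sum => // al _; apply: (fr_mul ringP); first exact: fr_cst.
by apply: fr_prod => // i; apply: fr_exp.
Qed.

End ParamPoly.

(** * Upper bound on the length of chains *)

Section Dimension.
Variables (F : fieldType) (n : nat) (T : finType) (phi : (T -> F) -> sconst F n).
Hypothesis phi_poly : forall i j k, param_poly (fun x => phi x i j k).

(* Multiplying the functions attached to [Z d] by the powers [f ^ j], [j < m], of an
   equation [f] of [Z d] in [Z d.+1] keeps them independent: a relation can be
   divided by [f] on the irreducible [Z d.+1], then restricted to [Z d]. *)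
Lemma chain_independent_functions (Z : nat -> sconst F n -> Prop) d :
  (forall i, (i <= d)%N -> zclosed (Z i) /\ irreducible (Z i)) ->
  (forall i, (i < d)%N -> Defs.subset (Z i) (Z i.+1) /\
                          ~ Defs.subset (Z i.+1) (Z i)) ->
  exists C, forall m, exists (I : finType) (g : I -> sconst F n -> F),
    [/\ #|I| = (m ^ d)%N,
        forall i, is_polyfun (g i) /\ degree_le (C * m) (fun x => g i (phi x))
      & forall a : I -> F, (forall c, Z d c -> \sum_i a i * g i c = 0) ->
          forall i, a i = 0].
Proof.
elim: d => [|d IHd] Zirr Zlt.
  exists 0%N => m; exists unit, (fun _ _ => 1); split=> [|_|a a0 []].
  - by rewrite card_unit.
  - by split; [apply: pf_const | apply: degree_le_cst].
  - have [[c Zc] _] := (Zirr 0%N (leqnn _)).2.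
    by have := a0 c Zc; rewrite (bigD1 tt) //= big1 ?addr0 ?mulr1 // => -[].
have [||C indep] := IHd.
- by move=> i leid; apply: Zirr; apply: leqW.
- by move=> i ltid; apply: Zlt; apply: leqW.
have [subZ /existsNP[c1 /not_implyP[Zc1 nZc1]]] := Zlt d (ltnSn d).
have [f [Pf f0 fc1]] := zclosed_separate (Zirr d (leqnSn d)).1 nZc1.
have [e fe] := fr_polyfun (@param_poly_ring F T) phi_poly Pf.
exists (C + e)%N => m; have [I [g [cardI gP g_indep]]] := indep m.
have ringP := @polyfun_ring F n.
exists (I * 'I_m)%type, (fun (ij : I * 'I_m) c => g ij.1 c * f c ^+ ij.2).
split=> [|[i j]|a a0] /=.
- by rewrite card_prod cardI card_ord expnSr.
- have [gi_poly gi_deg] := gP i; split.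
    by apply: pf_mul => //; apply: fr_exp.
  apply: degree_le_widen (degree_le_mul gi_deg (degree_le_exp j fe)).
  by rewrite mulnDl leq_add2l leq_mul2l ltnW ?orbT.
have a0' c : Z d.+1 c -> \sum_i \sum_j a (i, j) * (g i c * f c ^+ j) = 0.
  by move=> Zc; rewrite pair_bigA /= -[RHS](a0 c Zc); apply: eq_bigr => -[].
suff ak k : forall j : 'I_m, (j < k)%N -> forall i, a (i, j) = 0.
  by move=> [i j]; apply: (ak j.+1).
elim: k => [//|k IHk] j; rewrite ltnS leq_eqVlt => /orP[/eqP jk|/IHk//].
pose G c := \sum_i \sum_(l < m | (k <= l)%N) a (i, l) * (g i c * f c ^+ (l - k)).
have PG : is_polyfun G.
  apply: fr_sum => // i _; apply: fr_sum => // l _; apply: pf_mul.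
    exact: pf_const.
  by apply: pf_mul; [apply: (gP i).1 | apply: fr_exp].
have fG c : Z d.+1 c -> f c ^+ k * G c = 0.
  move=> /a0' <-; rewrite mulr_sumr; apply: eq_bigr => i _.
  rewrite mulr_sumr [RHS](bigID (fun l : 'I_m => (k <= l)%N)) /=.
  rewrite [X in _ = _ + X]big1 ?addr0 => [|l]; last first.
    by rewrite -ltnNge => /IHk->; rewrite mul0r.
  apply: eq_bigr => l lekl; rewrite -{2}(subnKC lekl) exprD; ring.
have [fk0|G0] := irreducible_mul (Zirr _ (leqnn _)).2 (fr_exp ringP k Pf) PG fG.
  by have /eqP := fk0 c1 Zc1; rewrite expf_eq0 (negbTE fc1) andbF.
apply: g_indep => c Zc; rewrite -[RHS](G0 c (subZ c Zc)); apply: eq_bigr => i _.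
rewrite (bigD1 j) ?jk //= subnn expr0 mulr1 big1 ?addr0 // => l /andP[lekl lj].
by rewrite f0 // expr0n subn_eq0 leqNgt ltn_neqAle lekl -jk eq_sym lj !mulr0.
Qed.

Lemma dependent_family (I J : finType) (M : I -> J -> F) : (#|J| < #|I|)%N ->
  exists2 a : I -> F, (exists i, a i != 0) & forall j, \sum_i a i * M i j = 0.
Proof.
move=> ltJI; pose A := \matrix_(i < #|I|, j < #|J|) M (enum_val i) (enum_val j).
have /rowV0Pn[v /sub_kermxP vA v0] : kermx A != 0.
  by rewrite kermx_eq0 /row_free neq_ltn (leq_ltn_trans (rank_leq_col A)).
exists (fun i => v 0 (enum_rank i)).
  have /rV0Pn[i vi] := v0; exists (enum_val i); by rewrite enum_valK.
move=> j; move/rowP/(_ (enum_rank j)): vA; rewrite !mxE => vA.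
rewrite -[RHS]vA (reindex_onto enum_val enum_rank) /=; last first.
  by move=> i _; rewrite enum_rankK.
by apply: eq_big => [i|i _]; rewrite ?mxE enum_valK ?eqxx // enum_rankK.
Qed.

(** A linear relation between pullbacks by [phi] extends to the closure of the image, hence to the
    top of the chain. So the independent functions given by the chain cannot outnumber the monomials
    in [#|T|] variables. *)
Theorem param_chain_bound (V : sconst F n -> Prop) :
  Defs.subset V (zclosure (fun c => exists x, c = phi x)) -> ~ has_chain V #|T|.+1.
Proof.
move=> V_phi [Z [Zirr Zlt]].
have [|C indep] := @chain_independent_functions Z #|T|.+1 _ Zlt.
  by move=> i /Zirr[? []].
(* As [C * m + 1 <= C.+1 * m], there are at most [C.+1 ^ #|T| * m ^ #|T|] monomials, fewer than
   [m ^ #|T|.+1]. *)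
pose m := (C.+1 ^ #|T|).+1.
have [I [g [cardI gP g_indep]]] := indep m.
have [M gM] := choice (fun i => (gP i).2).
have [|a [i ai] aM] := @dependent_family I {ffun T -> 'I_(C * m).+1} M.
  rewrite card_ffun card_ord cardI expnS.
  apply: (@leq_ltn_trans (C.+1 ^ #|T| * m ^ #|T|)); last first.
    by rewrite ltn_pmul2r // expn_gt0.
  rewrite -expnMn; have [->//|T_gt0] := posnP #|T|.
  by rewrite leq_exp2r // mulSn addnC -addn1 leq_add2l.
have P_sum : is_polyfun (fun c => \sum_i a i * g i c).
  apply: (fr_sum (@polyfun_ring F n)) => i' _.
  by apply: pf_mul; [apply: pf_const | case: (gP i')].
have a0 c : Z #|T|.+1 c -> \sum_i a i * g i c = 0.
  move=> /(Zirr _ (leqnn _)).2.2/V_phi/mem_zclosureP/(_ _ P_sum); apply.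
  move=> _ [x ->]; under eq_bigr do rewrite gM mulr_sumr.
  rewrite exchange_big big1 // => al _ /=.
  by under eq_bigr do rewrite mulrA; rewrite -mulr_suml aM mul0r.
by move: ai; rewrite (g_indep a a0) eqxx.
Qed.

End Dimension.

(** * Irreducibility and chains from a parametrization *)

Section ParamVariety.
Variables (F : closedFieldType) (n : nat) (T : finType).
Variable phi : (T -> F) -> sconst F n.
Hypothesis phi_poly : forall i j k, param_poly (fun x => phi x i j k).

(** The line joining two parameters stays in [S] and is mapped to a polynomial curve; two
    polynomials that are each nonzero somewhere on this curve are nonzero at a common point. *)
Lemma irreducible_param (S : (T -> F) -> Prop) :
  (exists x, S x) ->
  (forall x y t, S x -> S y -> S (fun i => (1 - t) * x i + t * y i)) ->
  irreducible (zclosure (fun c => exists2 x, S x & c = phi x)).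
Proof.
move=> [x0 Sx0] S_line; apply: irreducible_zclosure.
  by exists (phi x0), x0.
move=> p q _ _ Pp Pq [x Sx ->] [y Sy ->] px qy.
pose z (t : F) i := (1 - t) * x i + t * y i.
have curve_z r : is_polyfun r -> poly_curve (fun t => r (phi (z t))).
  move=> Pr; apply: (fr_polyfun (@poly_curve_ring F)) Pr => i j k.
  apply: (param_poly_curve (phi_poly i j k)) => l; exact: poly_curve_line.
have z0 : z 0 = x by apply: funext => i; rewrite /z subr0 mul1r mul0r addr0.
have z1 : z 1 = y by apply: funext => i; rewrite /z subrr mul1r mul0r add0r.
have [||t pt qt] := poly_curve_avoid (a := 0) (b := 1) (curve_z p Pp) (curve_z q Pq).
- by rewrite z0.
- by rewrite z1.
by exists (phi (z t)); split=> //; exists (z t) => //; apply: S_line.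
Qed.

(** The chain consists of the closures of the images of coordinate subspaces, the coordinates being
    freed one by one in the order of [key]. The function [f i] shows that freeing [i] enlarges the
    closure. *)
Lemma param_has_chain (V : sconst F n -> Prop) (key : T -> nat)
    (f : T -> sconst F n -> F) :
  Defs.subset (zclosure (fun c => exists x, c = phi x)) V ->
  injective key ->
  (forall i, is_polyfun (f i)) ->
  (forall i x, (forall j, x j != 0 -> (key j < key i)%N) -> f i (phi x) = 0) ->
  (forall i, exists2 x, (forall j, x j != 0 -> (key j <= key i)%N) &
                        f i (phi x) != 0) ->
  has_chain V #|T|.
Proof.
move=> phiV key_inj Pf f_vanish f_sep.
pose le_key i j := (key i <= key j)%N.
pose s := sort le_key (enum T).
have le_key_trans : transitive le_key by move=> j i k; apply: leq_trans.
have s_sorted : sorted le_key s by apply: sort_sorted => i j; exact: leq_total.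
have s_uniq : uniq s by rewrite sort_uniq enum_uniq.
have mem_s i : i \in s by rewrite mem_sort mem_enum.
have size_s : size s = #|T| by rewrite size_sort -cardE.
(* Positions in the sorted list renumber the keys without gaps, as the indices of a chain
   require. *)
have idx_key i j : (index i s < index j s)%N = (key i < key j)%N.
  have le_idx a b : (index a s <= index b s)%N -> (key a <= key b)%N.
    apply: (sorted_leq_index le_key_trans _ s_sorted) => // l; exact: leqnn.
  have [ltij|/le_idx leji] := ltnP (index i s) (index j s).
    rewrite [RHS]ltn_neqAle le_idx 1?ltnW // andbT; apply/esym.
    by apply: contraTneq ltij => /key_inj->; rewrite ltnn.
  by rewrite ltnNge leji.
pose S k (x : T -> F) := forall j, x j != 0 -> (index j s < k)%N.
exists (fun k => zclosure (fun c => exists2 x, S k x & c = phi x)).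
split=> [k lek|k ltk].
  split; first exact: zclosed_zclosure.
  split; last first.
    move=> c clc; apply: phiV; apply: (zclosure_sub (zclosed_zclosure _)) clc.
    by move=> _ [x _ ->]; apply: sub_zclosure; exists x.
  apply: irreducible_param => [|x y t Sx Sy j].
    by exists (fun=> 0) => j; rewrite eqxx.
  have [->|/Sx//] := eqVneq (x j) 0; have [->|/Sy//] := eqVneq (y j) 0.
  by rewrite !mulr0 addr0 eqxx.
split.
  apply: (zclosure_sub (zclosed_zclosure _)) => _ [x Sx ->].
  by apply: sub_zclosure; exists x => // j /Sx/ltnW.
have /card_gt0P[i0 _] : (0 < #|T|)%N by apply: leq_ltn_trans ltk.
rewrite -size_s in ltk.
pose i := nth i0 s k; have idx_i : index i s = k by rewrite index_uniq.
have [x x_supp fx] := f_sep i => sub_k.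
have /mem_zclosureP/(_ _ (Pf i)) : zclosure (fun c => exists2 x, S k x & c = phi x) (phi x).
  apply: sub_k; apply: sub_zclosure; exists x => // j /x_supp.
  by rewrite leqNgt -idx_key idx_i -leqNgt ltnS.
move=> fx0; move: fx; rewrite fx0 ?eqxx // => _ [y Sy ->].
by apply: f_vanish => j /Sy; rewrite -idx_key idx_i.
Qed.

End ParamVariety.

(** * Nilpotent structures and adapted bases *)

Section StrictTriangularization.
Variables (F : fieldType) (I : Type).

(** The head of the word is the rightmost factor: it acts first on column vectors. *)
Definition mprod n (M : I -> 'M[F]_n) (s : seq I) : 'M_n :=
  foldr (fun i P => P *m M i) 1%:M s.

Definition strict_trig n (A : 'M[F]_n) := forall k j : 'I_n, (k <= j)%N -> A k j = 0.

Lemma mprod_conj n (M : I -> 'M[F]_n) (h h' : 'M_n) s : h *m h' = 1%:M ->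
  mprod (fun i => h *m M i *m h') s = h *m mprod M s *m h'.
Proof.
move=> hh'; elim: s => [|i s IHs] /=; first by rewrite mulmx1 hh'.
by rewrite IHs !mulmxA -(mulmxA _ h') (mulmx1C hh') mulmx1.
Qed.

(** Each factor pushes the support at least one step further below the diagonal. *)
Lemma mprod_strict_trig n (M : I -> 'M[F]_n) s :
  (forall i, strict_trig (M i)) ->
  forall k j : 'I_n, (k < j + size s)%N -> mprod M s k j = 0.
Proof.
move=> trigM; elim: s => [|i s IHs] k j /=.
  by rewrite addn0 => ltkj; rewrite mxE -val_eqE /= ltn_eqF.
move=> ltk; rewrite mxE big1 // => l _; have [lelj|ltjl] := leqP l j.
  by rewrite trigM // mulr0.
by rewrite IHs ?mul0r // (leq_trans ltk) // addnS -addSn leq_add2r.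
Qed.

(** Take a nonzero product of maximal length: multiplied by any [M i] it gives zero, so any nonzero
    vector of its row space works. *)
Lemma common_left_kernel n (M : I -> 'M[F]_n) K : (0 < n)%N ->
  (forall s, size s = K -> mprod M s = 0) ->
  exists2 u : 'rV_n, u != 0 & forall i, u *m M i = 0.
Proof.
move=> n_gt0; elim: K => [|K IHK] M0.
  have /matrixP/(_ (Ordinal n_gt0) (Ordinal n_gt0)) := M0 [::] erefl.
  by rewrite !mxE eqxx => /eqP; rewrite oner_eq0.
have [/IHK//|/existsNP[s /not_implyP[sK /eqP Ms]]] :=
  pselect (forall s, size s = K -> mprod M s = 0).
have /rowV0Pn[u /submxP[v uE] u0] := Ms.
exists u => // i; have Ms_i : mprod M s *m M i = 0 by apply: (M0 (i :: s)); rewrite /= sK.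
by rewrite uE -mulmxA Ms_i mulmx0.
Qed.

(** An Engel-type induction on the size. With a common left kernel vector as first row of the change
    of basis, every conjugated matrix has zero first row, and its lower right block inherits the
    vanishing of long products. *)
Lemma strict_triangularization n (M : I -> 'M[F]_n) K :
  (forall s, size s = K -> mprod M s = 0) ->
  exists h h' : 'M_n, h *m h' = 1%:M /\ forall i, strict_trig (h *m M i *m h').
Proof.
elim: n M => [|n IHn] M M0.
  by exists 1%:M, 1%:M; rewrite mulmx1; split=> // i [].
have [//|u u0 uM] := common_left_kernel _ M0.
(* [row_ebase u] is an invertible matrix whose first row is proportional to [u]. *)
pose h := row_ebase u : 'M_(1 + n); pose h' := invmx h.
have hh' : h *m h' = 1%:M by rewrite mulmxV // row_ebase_unit.
pose N i : 'M_(1 + n) := h *m (M i : 'M_(1 + n)) *m h'.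
have N0 i j : N i (lshift n 0) j = 0.
  have : pid_mx 1 *m N i = 0 :> 'rV_(1 + n).
    have rk_u : \rank u = 1%N by apply/eqP; rewrite eqn_leq rank_leq_row lt0n mxrank_eq0.
    have : invmx (col_ebase u) *m (u *m M i) *m h' = 0 by rewrite uM mulmx0 mul0mx.
    rewrite mulmxA -{2}[u]mulmx_ebase rk_u 2!mulmxA mulVmx ?col_ebase_unit // mul1mx.
    by rewrite /N !mulmxA.
  have -> : lshift n (0 : 'I_1) = ord0 by apply: val_inj.
  move/rowP/(_ j); rewrite [LHS]mxE [RHS]mxE big_ord_recl big1 => [|k _].
    by rewrite mxE addr0 mul1r.
  by rewrite mxE mul0r.
have NE i : N i = block_mx 0 0 (dlsubmx (N i)) (drsubmx (N i)).
  rewrite -{1}[N i]submxK; congr block_mx; apply/matrixP => a b;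
  by rewrite ord1 2![LHS]mxE [RHS]mxE N0.
have [s|g [g' [gg' g_trig]]] := IHn (fun i => drsubmx (N i)).
  have [a [b ab]] : exists a b, mprod N s = block_mx a 0 b (mprod (fun i => drsubmx (N i)) s).
    elim: s => [|i s [a [b /= ->]]]; first by exists 1%:M, 0; rewrite -scalar_mx_block.
    rewrite {1}NE mulmx_block !(mulmx0, mul0mx, addr0, add0r).
    by exists 0, (mprod (fun i => drsubmx (N i)) s *m dlsubmx (N i)).
  move=> sK; have : mprod N s = 0 by rewrite mprod_conj // M0 // mulmx0 mul0mx.
  by rewrite ab => /(congr1 drsubmx); rewrite block_mxKdr => ->; apply/matrixP => k l; rewrite !mxE.
change (exists h h' : 'M_(1 + n), h *m h' = 1%:M /\
  forall i, strict_trig (h *m (M i : 'M_(1 + n)) *m h')).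
exists (block_mx 1%:M 0 0 g *m h), (h' *m block_mx 1%:M 0 0 g'); split.
  rewrite mulmxA -(mulmxA _ h) hh' mulmx1 mulmx_block !(mulmx0, mul0mx, addr0, add0r).
  by rewrite gg' mulmx1 -scalar_mx_block.
move=> i k j; rewrite mulmxA -(mulmxA _ h) -(mulmxA _ _ h') -/(N i) NE.
rewrite !mulmx_block !(mulmx0, mul0mx, addr0, add0r).
rewrite -[k]splitK -[j]splitK; case: (split k) => {}k; case: (split j) => {}j /= lekj.
- by rewrite block_mxEul mxE.
- by rewrite block_mxEur mxE.
- by move: lekj; rewrite ord1.
- by rewrite block_mxEdr g_trig // -(leq_add2l 1).
Qed.

End StrictTriangularization.

(** * Changes of basis *)

Section ChangeOfBasis.
Variables (F : fieldType) (n : nat).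
Implicit Types (c w : sconst F n) (g h : 'M[F]_n).

(** Left multiplication by [e_i] on column vectors; [condStar] makes it strictly lower
    triangular. *)
Definition lmx c (i : 'I_n) : 'M[F]_n := \matrix_(k, j) c i j k.

Lemma lmx_inj c c' : lmx c =1 lmx c' -> c = c'.
Proof.
move=> E; apply: sconst_eqP => i j k.
by have /matrixP/(_ k j) := E i; rewrite !mxE.
Qed.

(* [h] stands for the inverse of [g]; keeping it independent lets [\adj g] play its
   role, which makes everything polynomial in [g]. *)
Definition act2 g h c : sconst F n :=
  fun i j k => \sum_a \sum_b \sum_l g a i * g b j * c a b l * h k l.

Lemma lmx_act2 g h c i :
  lmx (act2 g h c) i = \sum_a g a i *: (h *m lmx c a *m g).
Proof.
apply/matrixP => k j; rewrite summxE mxE; apply: eq_bigr => a _.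
rewrite !mxE mulr_sumr; apply: eq_bigr => b _.
rewrite !mxE mulr_suml mulr_sumr; apply: eq_bigr => l _; rewrite mxE; ring.
Qed.

Lemma act2_comp g1 h1 g2 h2 c :
  act2 g2 h2 (act2 g1 h1 c) = act2 (g1 *m g2) (h2 *m h1) c.
Proof.
apply: lmx_inj => i; rewrite !lmx_act2.
under eq_bigr do rewrite lmx_act2 mulmx_sumr mulmx_suml scaler_sumr.
rewrite exchange_big; apply: eq_bigr => a _ /=.
rewrite mxE scaler_suml; apply: eq_bigr => b _.
by rewrite -scalemxAr -scalemxAl scalerA mulrC !mulmxA.
Qed.

Lemma act2_1 c : act2 1%:M 1%:M c = c.
Proof.
apply: lmx_inj => i; rewrite lmx_act2 (bigD1 i) //= big1 ?addr0 => [|a /negbTE ai].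
  by rewrite mxE eqxx scale1r mul1mx mulmx1.
by rewrite mxE ai scale0r.
Qed.

Lemma act2K g h c : h *m g = 1%:M -> act2 h g (act2 g h c) = c.
Proof. by move=> hg; rewrite act2_comp (mulmx1C hg) act2_1. Qed.

Lemma actE g h c : h *m g = 1%:M -> act g c = act2 g h c.
Proof.
move=> hg; have [_ g_unit] := mulmx1_unit hg.
by have -> : h = invmx g by rewrite -[RHS]mul1mx -hg mulmxK.
Qed.

Lemma act2_scale g h c a : act2 g h (fun i j k => a * c i j k) = act2 g (a *: h) c.
Proof.
apply: sconst_eqP => i j k; apply: eq_bigr => l _; apply: eq_bigr => b _.
by apply: eq_bigr => m _; rewrite mxE; ring.
Qed.

(** Multiplying by [g] clears [h]: both sides are the coordinate [m], in the old basis, of the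
    product of the new basis vectors [i] and [j]. *)
Lemma act2_mul g h c i j m : h *m g = 1%:M ->
  \sum_k g m k * act2 g h c i j k = \sum_a \sum_b g a i * g b j * c a b m.
Proof.
move=> hg; under eq_bigr do rewrite mulr_sumr.
rewrite exchange_big; apply: eq_bigr => a _ /=.
under eq_bigr do rewrite mulr_sumr.
rewrite exchange_big; apply: eq_bigr => b _ /=.
under eq_bigr do rewrite mulr_sumr.
rewrite exchange_big (bigD1 m) //= [X in _ + X]big1 ?addr0 => [|l lm].
  under eq_bigr do rewrite mulrCA.
  have /matrixP/(_ m m) := mulmx1C hg; rewrite !mxE eqxx => gh.
  by rewrite -mulr_sumr gh mulr1.
under eq_bigr do rewrite mulrCA.
have /matrixP/(_ m l) := mulmx1C hg; rewrite !mxE eq_sym (negbTE lm) => gh.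
by rewrite -mulr_sumr gh mulr0.
Qed.

Lemma commutative_act2 g h c : commutative_sc c -> commutative_sc (act2 g h c).
Proof.
move=> cC i j k; rewrite /act2 exchange_big; apply: eq_bigr => a _.
by apply: eq_bigr => b _; apply: eq_bigr => l _; rewrite cC; ring.
Qed.

Lemma fr_act2 (X : Type) (P : (X -> F) -> Prop) (g h : X -> 'M[F]_n) (c : X -> sconst F n) :
  function_ring P ->
  (forall i j, P (fun x => g x i j)) -> (forall i j, P (fun x => h x i j)) ->
  (forall i j k, P (fun x => c x i j k)) ->
  forall i j k, P (fun x => act2 (g x) (h x) (c x) i j k).
Proof.
move=> ringP Pg Ph Pc i j k; rewrite /act2.
apply: fr_sum => // a _; apply: fr_sum => // b _; apply: fr_sum => // l _.
by do 3!apply: (fr_mul ringP) => //.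
Qed.

End ChangeOfBasis.

(** * Nilpotency through words in the left multiplications *)

Section Nilpotent.
Variables (F : fieldType) (n : nat).
Implicit Types (c w : sconst F n) (g h : 'M[F]_n).

Definition star_alg w := commutative_sc w /\ condStar w.

Definition vcol (x : vec F n) : 'cV[F]_n := \col_k x k.

Lemma vcol_amul c x y : vcol (amul c x y) = \sum_i x i *: (lmx c i *m vcol y).
Proof.
apply/matrixP => k ?; rewrite summxE mxE; apply: eq_bigr => i _.
rewrite !mxE mulr_sumr; apply: eq_bigr => j _; rewrite !mxE; ring.
Qed.

Definition unit_vec (i : 'I_n) : vec F n := fun j => (j == i)%:R.

Lemma inpow_gt0 c k x : inpow c k x -> (0 < k)%N.
Proof. by elim=> // l i y z i_gt0 ltil *; apply: ltn_trans ltil. Qed.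

Lemma inpow_mprod c s k x : inpow c k x ->
  inpow c (k + size s) (fun l => (mprod (lmx c) s *m vcol x) l 0).
Proof.
elim: s k x => [|i s IHs] k x xk /=.
  by rewrite addn0 mul1mx; move: xk; congr inpow; apply: funext => l; rewrite mxE.
rewrite addnS -addSn -mulmxA.
have -> : lmx c i *m vcol x = vcol (amul c (unit_vec i) x).
  rewrite vcol_amul (bigD1 i) //= big1 => [|j /negbTE ji].
    by rewrite /unit_vec eqxx scale1r addr0.
  by rewrite /unit_vec ji scale0r.
apply: IHs; apply: (@ip_prod _ _ _ _ 1) => //.
- by rewrite ltnS (inpow_gt0 xk).
- exact: ip_one.
- by rewrite subn1.
Qed.

(** A word of length [K - 1] sends [N] into [N^K = 0]. *)
Lemma nilpotent_mprod c : nilpotent_sc c ->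
  exists K, forall s, size s = K -> mprod (lmx c) s = 0.
Proof.
move=> [K [K_gt0 NK]]; exists K.-1 => s sK; apply/matrixP => k j; rewrite [RHS]mxE.
have := inpow_mprod s (ip_one c (unit_vec j)).
rewrite sK add1n prednK // => /NK/(_ k) <-.
rewrite mxE (bigD1 j) //= big1 ?addr0 => [|l /negbTE lj].
  by rewrite mxE /unit_vec eqxx mulr1.
by rewrite mxE /unit_vec lj mulr0.
Qed.

Lemma star_alg_strict_trig w i : star_alg w -> strict_trig (lmx w i).
Proof. by move=> [_ wS] k j lekj; rewrite mxE wS // leq_max lekj orbT. Qed.

(** The left multiplications of the new structure are conjugate to combinations of strictly
    triangular matrices, and [n] such factors of size [n] have zero product. *)
Lemma mprod_act2_star g h w s : h *m g = 1%:M -> star_alg w -> size s = n ->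
  mprod (lmx (act2 g h w)) s = 0.
Proof.
move=> hg wS sn; pose S i := \sum_a g a i *: lmx w a.
have -> : lmx (act2 g h w) = (fun i => h *m S i *m g).
  apply: funext => i; rewrite lmx_act2 mulmx_sumr mulmx_suml; apply: eq_bigr => a _.
  by rewrite -scalemxAr -scalemxAl.
rewrite mprod_conj //; suff -> : mprod S s = 0 by rewrite mulmx0 mul0mx.
apply/matrixP => k j; rewrite mprod_strict_trig ?mxE // => [i k' j' lek'j'|].
  rewrite summxE big1 // => a _; rewrite mxE star_alg_strict_trig ?mulr0 //.
by rewrite sn (leq_trans (ltn_ord k)) ?leq_addl.
Qed.

(** In a product of degree at least [2 ^ i.+1], one factor has degree at least [2 ^ i]. By
    commutativity it may be taken on the right; the other factor then acts by left multiplication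
    and only lengthens the word by one letter. *)
Lemma inpow_annihilated c : commutative_sc c ->
  (forall s, size s = n -> mprod (lmx c) s = 0) ->
  forall k x, inpow c k x -> forall i, (2 ^ i <= k)%N ->
  forall s, (n <= size s + i)%N -> mprod (lmx c) s *m vcol x = 0.
Proof.
move=> cC c0.
have c0' s : (n <= size s)%N -> mprod (lmx c) s = 0.
  elim: s => [|i s IHs] /=; first by rewrite leqn0 => /eqP n0; apply: (c0 [::]).
  rewrite leq_eqVlt => /orP[/eqP ns|]; first by apply: (c0 (i :: s)).
  by rewrite ltnS => /IHs->; rewrite mul0mx.
have amulC x y : amul c x y = amul c y x.
  apply: funext => k; rewrite /amul exchange_big; apply: eq_bigr => i _.
  by apply: eq_bigr => j _; rewrite cC [x j * _]mulrC.
have step x y i s : (forall s', (n <= size s' + i)%N -> mprod (lmx c) s' *m vcol y = 0) ->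
    (n <= size s + i.+1)%N -> mprod (lmx c) s *m vcol (amul c x y) = 0.
  move=> y0 les; rewrite vcol_amul mulmx_sumr big1 // => j _.
  rewrite -scalemxAr mulmxA (y0 (j :: s)) ?scaler0 //=.
  by rewrite addSn -addnS.
move=> k x; elim=> {k x}.
- move=> x [|i] le1 s; first by rewrite addn0 => /c0'->; rewrite mul0mx.
  by move: le1; rewrite leqNgt -{1}(expn0 2) ltn_exp2l.
- move=> k _ i _ s _; have -> : vcol (fun=> 0) = 0 by apply/matrixP => ? ?; rewrite !mxE.
  by rewrite mulmx0.
- move=> k a x y a_gt0 ltak _ IHx _ IHy [|i] lek s les.
    by rewrite c0' ?mul0mx // -[size s]addn0.
  have [lea|lta] := leqP (2 ^ i) a.
    by rewrite amulC; apply: (step _ _ i) => // s'; apply: IHx.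
  apply: (step _ _ i) => // s'; apply: IHy; move: lek; rewrite expnS; lia.
- move=> k x y _ IHx _ IHy i lek s les.
  have -> : vcol (fun l => x l + y l) = vcol x + vcol y.
    by apply/matrixP => ? ?; rewrite !mxE.
  by rewrite mulmxDr (IHx i) ?(IHy i) ?addr0.
- move=> k a x _ IHx i lek s les.
  have -> : vcol (fun l => a * x l) = a *: vcol x.
    by apply/matrixP => ? ?; rewrite !mxE.
  by rewrite -scalemxAr (IHx i) ?scaler0.
Qed.

(** With the empty word and [i = n], [inpow_annihilated] shows that [N^(2^n) = 0]. *)
Lemma comm_nilp_mprod c : commutative_sc c ->
  (forall s, size s = n -> mprod (lmx c) s = 0) -> comm_nilp c.
Proof.
move=> cC c0; split=> //; exists (2 ^ n)%N; split=> [|x xn l]; first exact: expn_gt0.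
have := inpow_annihilated cC c0 xn (leqnn _) (s := [::]) (leqnn _).
by rewrite mul1mx => /matrixP/(_ l 0); rewrite !mxE.
Qed.

(** Strictly triangularising all left multiplications together gives the vanishing for [k <= j];
    commutativity gives it for [k <= i]. *)
Lemma comm_nilpP c : comm_nilp c <->
  exists g h w, [/\ h *m g = 1%:M, star_alg w & c = act2 g h w].
Proof.
split=> [[cC /nilpotent_mprod[K cK]]|[g [h [w [hg [wC wS] ->]]]]]; last first.
  apply: comm_nilp_mprod => [|s]; first exact: commutative_act2.
  exact: mprod_act2_star.
have [h [g [hg trig]]] := strict_triangularization cK.
exists h, g, (act2 g h c); split; first exact: mulmx1C.
  have cC' := commutative_act2 g h cC; split=> // i j k.
  have c0 (i' j' : 'I_n) : (k <= j')%N -> act2 g h c i' j' k = 0.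
    move=> lekj; have /matrixP/(_ k j') := lmx_act2 g h c i'; rewrite mxE => ->.
    by rewrite summxE big1 // => a _; rewrite mxE trig ?mulr0.
  by rewrite leq_max => /orP[/c0|/c0//]; rewrite cC'.
by rewrite act2K.
Qed.

(** The equations are commutativity and the vanishing of the words of length [n] in the left
    multiplications; by [comm_nilpP] this length suffices whatever the nilpotency index. *)
Lemma zclosed_comm_nilp : zclosed (@comm_nilp F n).
Proof.
exists (fun p => (exists i j k, p = fun c => c i j k - c j i k) \/
  exists s k j, size s = n /\ p = fun c => mprod (lmx c) s k j); split.
  move=> p [[i [j [k ->]]]|[s [k [j [_ ->]]]]].
    by apply: fr_sub; [exact: polyfun_ring|exact: pf_coord|exact: pf_coord].
  elim: s j k => [|i s IHs] j k /=.
    by have := pf_const n ((k == j)%:R : F); congr is_polyfun; apply: funext => c; rewrite mxE.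
  have -> : (fun c => (mprod (lmx c) s *m lmx c i) k j) =
            (fun c => \sum_l mprod (lmx c) s k l * c i j l).
    by apply: funext => c; rewrite mxE; apply: eq_bigr => l _; rewrite mxE.
  apply: fr_sum => [|l _]; first exact: polyfun_ring.
  by apply: pf_mul => //; apply: pf_coord.
move=> c; split.
  move=> cV p [[i [j [k ->]]]|[s [k [j [sn ->]]]]].
    by rewrite cV.1 subrr.
  have /comm_nilpP[g [h [w [hg wS ->]]]] := cV.
  by rewrite mprod_act2_star // mxE.
move=> c0; apply: comm_nilp_mprod => [i j k|s sn].
  apply/eqP; rewrite -subr_eq0; apply/eqP.
  by apply: (c0 (fun c => c i j k - c j i k)); left; exists i, j, k.
apply/matrixP => k j; rewrite mxE.
by apply: (c0 (fun c => mprod (lmx c) s k j)); right; exists s, k, j.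
Qed.

End Nilpotent.

(** * The parametrization of the variety *)

Section TriangularFactorization.
Variable F : fieldType.

Definition upper_unitri n (U : 'M[F]_n) :=
  forall i j : 'I_n, (j <= i)%N -> U i j = (i == j)%:R.

(** Gaussian elimination along a curve: [Q] collects the successive pivots, cleared of
    denominators. *)
Lemma generic_LU n (A : F -> 'M[F]_n) :
  (forall i j, poly_curve (fun t => A t i j)) -> A 1 = 1%:M ->
  exists Q : F -> F, [/\ poly_curve Q, Q 1 != 0 & forall t, Q t != 0 ->
    exists L L' U : 'M_n, [/\ is_trig_mx L, is_trig_mx L', L *m L' = 1%:M,
      upper_unitri U & A t = L *m U]].
Proof.
have ringP := @poly_curve_ring F.
elim: n A => [|n IHn] A PA A1.
  exists (fun=> 1); split=> [||t _]; [exact: fr_cst | exact: oner_neq0 |].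
  exists 1%:M, 1%:M, 1%:M; rewrite !mulmx1; split=> //; try exact: scalar_mx_is_trig.
    by move=> [].
  by apply/matrixP => -[].
pose B t : 'M_(1 + n) := A t.
pose a t := B t 0 0; pose r t := ursubmx (B t); pose c t := dlsubmx (B t).
have BE t : B t = block_mx (a t)%:M (r t) (c t) (drsubmx (B t)).
  rewrite -{1}[B t]submxK [ulsubmx _]mx11_scalar; congr (block_mx _%:M _ _ _).
  by rewrite 2!mxE; congr (B t _ _); apply: val_inj.
(* The Schur complement times the pivot [a t]: its entries stay polynomial, and it is still the
   identity at [t = 1]. *)
pose A2 t := a t *: drsubmx (B t) - c t *m r t.
have [i j||Q [PQ Q1 LU]] := IHn A2.
- have -> : (fun t => A2 t i j) = (fun t => a t * B t (rshift 1 i) (rshift 1 j)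
      - B t (rshift 1 i) (lshift n 0) * B t (lshift n 0) (rshift 1 j)).
    by apply: funext => t; rewrite !mxE big_ord1 !mxE.
  apply: fr_sub => //; apply: (fr_mul ringP); exact: PA.
- have B1 : B 1 = block_mx 1%:M 0 0 1%:M by rewrite -scalar_mx_block.
  rewrite /A2 /a /r /c {1}/B A1 B1 block_mxKur block_mxKdl block_mxKdr mul0mx subr0.
  by rewrite mxE eqxx scale1r.
exists (fun t => a t * Q t); split=> [||t].
- by apply: (fr_mul ringP) => //; apply: PA.
- by rewrite /a /B A1 mxE eqxx mul1r.
rewrite mulf_eq0 negb_or => /andP[at0 /LU[L [L' [U [trigL trigL' LL' uniU A2E]]]]].
change (exists L L' U : 'M[F]_(1 + n), [/\ is_trig_mx L, is_trig_mx L',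
  L *m L' = 1%:M, upper_unitri U & B t = L *m U]).
(* Dividing [L] by [a t] undoes the scaling of the Schur complement. *)
exists (block_mx (a t)%:M 0 (c t) ((a t)^-1 *: L)),
  (block_mx (a t)^-1%:M 0 (- (L' *m c t)) (a t *: L')),
  (block_mx 1%:M ((a t)^-1 *: r t) 0 U); split.
- rewrite is_trig_block_mx // eqxx scalar_mx_is_trig /=.
  by apply/is_trig_mxP => i j /(is_trig_mxP trigL) Lij; rewrite mxE Lij mulr0.
- rewrite is_trig_block_mx // eqxx scalar_mx_is_trig /=.
  by apply/is_trig_mxP => i j /(is_trig_mxP trigL') Lij; rewrite mxE Lij mulr0.
- rewrite mulmx_block !(mulmx0, mul0mx, addr0, add0r) -scalar_mxM divff //.
  rewrite mul_mx_scalar mulmxN -scalemxAl mulmxA LL' mul1mx subrr.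
  by rewrite -scalemxAl -scalemxAr scalerA LL' mulVf // scale1r -scalar_mx_block.
- move=> k j; rewrite -[k]splitK -[j]splitK.
  case: (split k) => {}k; case: (split j) => {}j /= lejk.
  + by rewrite block_mxEul mxE !ord1 eqxx.
  + by case: k lejk => [[]].
  + by rewrite block_mxEdl mxE eq_rlshift.
  + by rewrite block_mxEdr eq_rshift uniU // -(leq_add2l 1).
- rewrite mulmx_block !(mulmx0, mul0mx, addr0, add0r, mulmx1) mul_scalar_mx scalerA.
  rewrite divff // scale1r -scalemxAl -A2E /A2 -scalemxAr scalerBr scalerA.
  by rewrite mulVf // scale1r addrC subrK -BE.
Qed.

Lemma upper_unitri_det n (U : 'M[F]_n) : upper_unitri U -> \det U = 1.
Proof.
move=> uniU; rewrite -det_tr det_trig.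
  by rewrite big1 // => i _; rewrite mxE uniU ?eqxx.
apply/is_trig_mxP => i j ltij; rewrite mxE uniU 1?ltnW //.
by rewrite -val_eqE /= gtn_eqF.
Qed.

Lemma upper_unitri_adj n (U : 'M[F]_n) : upper_unitri U -> \adj U *m U = 1%:M.
Proof. by move=> uniU; rewrite mul_adj_mx upper_unitri_det. Qed.

(** The new basis vector [i] only involves old ones of index at least [i], so the flag behind
    [condStar] is preserved. *)
Lemma star_alg_act2_trig n (L L' : 'M[F]_n) w :
  is_trig_mx L -> is_trig_mx L' -> star_alg w -> star_alg (act2 L L' w).
Proof.
move=> /is_trig_mxP trigL /is_trig_mxP trigL' [wC wS].
split; first exact: commutative_act2.
move=> i j k lek; rewrite /act2 big1 // => a _; rewrite big1 // => b _.
rewrite big1 // => l _.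
have [ltai|leia] := ltnP a i; first by rewrite trigL // !mul0r.
have [ltbj|lejb] := ltnP b j; first by rewrite (trigL b j) // mulr0 !mul0r.
have [ltkl|lelk] := ltnP k l; first by rewrite (trigL' k l) // mulr0.
by rewrite wS ?mulr0 ?mul0r //; apply: leq_trans lelk (leq_trans lek _); lia.
Qed.

End TriangularFactorization.

Section Parametrization.
Variable n : nat.

Definition coord_raw := ('I_n * 'I_n + 'I_n * 'I_n * 'I_n)%type.

(** [inl (m, l)] is an entry of the unitriangular matrix, [inr (i, j, k)] a structure constant;
    [i <= j] keeps one of each pair exchanged by commutativity. *)
Definition coord_valid (u : coord_raw) : bool :=
  match u with inl (m, l) => (m < l)%N | inr (i, j, k) => (i <= j < k)%N end.

Definition star_coord := {u | coord_valid u}.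

Variable F : fieldType.
Implicit Types (x : star_coord -> F) (u : coord_raw).

Definition xval x u : F := oapp x 0 (insub u).

Definition gmx x : 'M[F]_n :=
  \matrix_(i, j) if i == j then 1 else xval x (inl (i, j)).

Definition wsc x : sconst F n := fun i j k =>
  xval x (inr (if (i <= j)%N then (i, j, k) else (j, i, k))).

(** [gmx x] has determinant 1, so its adjugate is its inverse and the map is polynomial. *)
Definition star_param x : sconst F n := act2 (gmx x) (\adj (gmx x)) (wsc x).

Lemma xval_invalid x u : ~~ coord_valid u -> xval x u = 0.
Proof. by move=> nv; rewrite /xval insubN. Qed.

Lemma xval_comp (y : coord_raw -> F) u :
  xval (fun v => y (val v)) u = if coord_valid u then y u else 0.
Proof. by rewrite /xval; case: insubP => [v -> <- //|/negbTE->]. Qed.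

Lemma xval_poly u : param_poly (fun x => xval x u).
Proof.
rewrite /xval; case: insubP => [v _ _|_] /=; first exact: param_poly_coord.
exact: (fr_cst (param_poly_ring F _)).
Qed.

Lemma gmx_unitri x : upper_unitri (gmx x).
Proof.
move=> i j leji; rewrite mxE; case: eqP => // _.
by rewrite xval_invalid //= -leqNgt.
Qed.

Lemma gmx_adj x : \adj (gmx x) *m gmx x = 1%:M.
Proof. exact/upper_unitri_adj/gmx_unitri. Qed.

Lemma wsc_star x : star_alg (wsc x).
Proof.
split=> [i j k|i j k lek]; last first.
  rewrite /wsc xval_invalid //; move: lek; rewrite /coord_valid.
  by case: (leqP i j); lia.
rewrite /wsc; case: (ltngtP i j) => // /val_inj-> //.
Qed.

Lemma star_param_poly i j k : param_poly (fun x => star_param x i j k).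
Proof.
have ringP := @param_poly_ring F star_coord.
have Pg a b : param_poly (fun x => gmx x a b).
  have [->|ab] := eqVneq a b.
    by have := fr_cst ringP 1; congr param_poly; apply: funext => x; rewrite mxE eqxx.
  have := xval_poly (inl (a, b)); congr param_poly; apply: funext => x.
  by rewrite mxE (negbTE ab).
apply: (fr_act2 ringP) => //; first exact: (fr_adj ringP).
by move=> a b l; apply: xval_poly.
Qed.

Lemma star_param_surj (U : 'M[F]_n) (w : sconst F n) :
  upper_unitri U -> star_alg w -> exists x, star_param x = act2 U (\adj U) w.
Proof.
move=> uniU [wC wS]; pose y (u : coord_raw) := match u with
  inl (i, j) => U i j | inr (i, j, k) => w i j k end.
exists (fun v => y (val v)); rewrite /star_param.
have -> : gmx (fun v => y (val v)) = U.
  apply/matrixP => i j; rewrite mxE xval_comp /=; case: eqP => [->|ij].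
    by rewrite uniU // eqxx.
  by case: ltnP => // /uniU->; case: eqP ij.
congr act2; apply: sconst_eqP => i j k; rewrite /wsc xval_comp.
have [leij|ltji] := leqP i j => /=.
  rewrite leij /=; case: ltnP => // lek; rewrite wS // (leq_trans lek) //; lia.
rewrite (ltnW ltji) /=; case: ltnP => [_|lek]; first exact: wC.
by rewrite wS // (leq_trans lek) //; lia.
Qed.

End Parametrization.

(** There are [n(n-1)/2] pairs [m < l], and for each [k] there are [k(k+1)/2] pairs [i <= j < k]. *)
Lemma card_coord n : #|{: star_coord n}| = (n * (n - 1) * (n + 4) %/ 6)%N.
Proof.
rewrite card_sig -sum1_card big_sumType /=.
have -> : (\sum_(p : 'I_n * 'I_n | coord_valid (inl p)) 1 = \sum_(l < n) l)%N.
  transitivity (\sum_(m < n) \sum_(l < n) if (m < l)%N then 1 else 0)%N.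
    by rewrite pair_bigA big_mkcond; apply: eq_bigr => -[].
  rewrite exchange_big; apply: eq_bigr => l _ /=.
  rewrite -big_mkcond /= -(big_ord_widen n (fun=> 1%N)) ?sum1_card ?card_ord //.
  exact: ltnW.
have -> : (\sum_(p : 'I_n * 'I_n * 'I_n | coord_valid (inr p)) 1
    = \sum_(k < n) \sum_(j < k) j.+1)%N.
  transitivity (\sum_(p : 'I_n * 'I_n) \sum_(k < n)
      if coord_valid (inr (p, k)) then 1 else 0)%N.
    by rewrite pair_bigA big_mkcond; apply: eq_bigr => -[].
  rewrite exchange_big; apply: eq_bigr => k _ /=.
  transitivity (\sum_(i < n) \sum_(j < n) if (i <= j < k)%N then 1 else 0)%N.
    by rewrite pair_bigA; apply: eq_bigr => -[].
  rewrite exchange_big /= (big_ord_widen n (fun j => j.+1)) ?[RHS]big_mkcond 1?ltnW //.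
  apply: eq_bigr => j _ /=; case: ltnP => _; last by rewrite big1 // => i _; rewrite andbF.
  under eq_bigr do rewrite andbT -ltnS.
  by rewrite -big_mkcond /= -(big_ord_widen n (fun=> 1%N)) ?sum1_card ?card_ord.
have S1 k : (2 * \sum_(j < k) j.+1 = k * k.+1)%N.
  elim: k => [|k IHk]; first by rewrite big_ord0.
  by rewrite big_ord_recr /= mulnDr IHk; nia.
suff : (6 * (\sum_(l < n) l + \sum_(k < n) \sum_(j < k) j.+1) = n * (n - 1) * (n + 4))%N.
  by move=> <-; rewrite mulKn.
elim: n => [|n IHn]; first by rewrite !big_ord0.
rewrite !big_ord_recr /=; have := S1 n; move: IHn.
rewrite subn1 /=; case: n => [|m] /=; first by lia.
rewrite subn1 /= => dE aE. nia.
Qed.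

Lemma adj_inverse (F : fieldType) n (g h : 'M[F]_n) :
  h *m g = 1%:M -> \adj g = \det g *: h.
Proof.
move=> hg; rewrite -[LHS]mulmx1 -(mulmx1C hg) mulmxA mul_adj_mx.
by rewrite mul_scalar_mx.
Qed.

Lemma star_alg_scale (F : fieldType) n (a : F) (w : sconst F n) :
  star_alg w -> star_alg (fun i j k => a * w i j k).
Proof.
by move=> [wC wS]; split=> i j k => [|lek]; [rewrite wC|rewrite wS ?mulr0].
Qed.

Section StarParametrization.
Variables (F : closedFieldType) (n : nat).
Implicit Types (g h : 'M[F]_n) (w : sconst F n).

(** Join [g] to the identity by a line. Where an LU factorization exists, [L] is absorbed into the
    structure and the result lies in the image of [star_param]; the vanishing of [p] then extends to
    the whole line. *)
Lemma star_param_image (p : sconst F n -> F) g h w :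
  is_polyfun p -> (forall x, p (star_param x) = 0) ->
  h *m g = 1%:M -> star_alg w -> p (act2 g h w) = 0.
Proof.
move=> Pp p0 hg wS; have ringP := @poly_curve_ring F.
have [_] := mulmx1_unit hg; rewrite unitmxE unitfE => det_g.
pose A t := (1 - t) *: g + t *: 1%:M.
have PA i j : poly_curve (fun t => A t i j).
  have := poly_curve_line (g i j) ((1%:M : 'M[F]_n) i j).
  by congr poly_curve; apply: funext => t; rewrite !mxE.
have A0 : A 0 = g by rewrite /A subr0 scale1r scale0r addr0.
have A1 : A 1 = 1%:M by rewrite /A subrr scale0r scale1r add0r.
have [Q [PQ Q1 LU]] := generic_LU PA A1.
(* Along the line the adjugate replaces the inverse at the cost of a determinant; the factor
   [(\det g)^-1] compensates for it at [t = 0]. *)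
pose w' i j k := (\det g)^-1 * w i j k.
have wS' : star_alg w' by apply: star_alg_scale.
suff pA t : p (act2 (A t) (\adj (A t)) w') = 0.
  have := pA 0; rewrite A0 act2_scale (adj_inverse hg).
  by rewrite scalerA mulVf // scale1r.
move: t; apply: (poly_curve_eq0 _ PQ Q1) => [|t /LU[L [L' [U [trL trL' LL' uniU AE]]]]].
  apply: (fr_polyfun ringP) Pp; apply: (fr_act2 ringP) => //.
    exact: (fr_adj ringP).
  by move=> i j k; apply: fr_cst.
have adjU := upper_unitri_adj uniU.
have AL : (\adj U *m L') *m A t = 1%:M.
  by rewrite AE mulmxA -(mulmxA _ L') (mulmx1C LL') mulmx1.
rewrite (adj_inverse AL) -act2_scale AE -act2_comp.
have [|x <-//] := star_param_surj uniU (w := act2 L L' (fun i j k => \det (L *m U) * w' i j k)).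
by apply: star_alg_act2_trig => //; apply: star_alg_scale.
Qed.

Lemma comm_nilp_star_param :
  seteq (@comm_nilp F n) (zclosure (fun c => exists x, c = star_param x)).
Proof.
move=> c; split=> [/comm_nilpP[g [h [w [hg wS ->]]]]|].
  apply/mem_zclosureP => p Pp p0; apply: star_param_image => // x.
  by apply: p0; exists x.
apply: zclosure_sub; first exact: zclosed_comm_nilp.
move=> _ [x ->]; apply/comm_nilpP; exists (gmx x), (\adj (gmx x)), (wsc x).
by split; [exact: gmx_adj | exact: wsc_star |].
Qed.

Lemma irreducible_comm_nilp : irreducible (@comm_nilp F n).
Proof.
rewrite (seteq_eq comm_nilp_star_param).
have -> : (fun c => exists x, c = star_param x) =
    (fun c : sconst F n => exists2 x, True & c = star_param x).
  by apply: funext => c; apply: propext; split=> [[x]|[x _]]; exists x.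
apply: irreducible_param => //; first exact: star_param_poly.
by exists (fun=> 0).
Qed.

(** Structure constants come first, then the entries of the matrix, by decreasing row and, within a
    row, by increasing column. *)
Definition raw_key (u : coord_raw n) : nat :=
  match u with
  | inl (m, l) => #|{: 'I_n * 'I_n * 'I_n}| + ((n - m) * n + l)
  | inr t => enum_rank t
  end.

Definition star_key (v : star_coord n) : nat := raw_key (val v).

Lemma star_key_inj : injective star_key.
Proof.
move=> [u uv] [v vv]; rewrite /star_key /raw_key /= => E; apply: val_inj => /=.
case: u v {uv vv} E => [[m l]|t] [[m' l']|t'] E.
- have n_gt0 : (0 < n)%N by apply: leq_ltn_trans (ltn_ord m).
  move/addnI: E => E; have := congr1 (modn^~ n) E; have := congr1 (divn^~ n) E.
  rewrite !divnMDl // !modnMDl !divn_small ?modn_small ?addn0 ?ltn_ord //.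
  move=> Em /val_inj->; congr (inl (_, _)); apply: val_inj => /=.
  by have := ltn_ord m; have := ltn_ord m'; lia.
- by have := ltn_ord (enum_rank t'); rewrite -E ltnNge leq_addr.
- by have := ltn_ord (enum_rank t); rewrite E ltnNge leq_addr.
- by have /enum_rank_inj-> := val_inj E.
Qed.

(* Row [m] of [g] is a linear relation between the coordinates [m <= k < l] of the squares
   [e_b^2], [m <= b < l], as long as the entries of [g] at and after [(m, l)], in the
   order of [star_key], are zero; the determinant of [square_mx m l] detects this. *)
Definition square_mx (m l : nat) (c : sconst F n) : 'M[F]_n :=
  \matrix_(k, b) if (m <= b < l)%N then
                   (if (m <= k < l)%N then c b b k else 0)
                 else (k == b)%:R.

(** This function detects the coordinate [v]. Structure constants are freed while the matrix is
    still the identity, so they are read off directly. *)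
Definition star_fun (v : star_coord n) (c : sconst F n) : F :=
  match val v with
  | inl (m, l) => \det (square_mx m l c)
  | inr (i, j, k) => c i j k
  end.

Lemma star_fun_poly v : is_polyfun (star_fun v).
Proof.
have ringP := @polyfun_ring F n.
case: v => u uv; rewrite /star_fun /=; case: u {uv} => [[m l]|[[i j] k]]; last exact: pf_coord.
apply: (fr_det ringP) => k b.
case mbl: (m <= b < l)%N; last first.
  by have := pf_const n ((k == b)%:R : F); congr is_polyfun; apply: funext => c;
     rewrite mxE mbl.
case mkl: (m <= k < l)%N.
  by have := pf_coord F b b k; congr is_polyfun; apply: funext => c; rewrite mxE mbl mkl.
by have := pf_const n (0 : F); congr is_polyfun; apply: funext => c; rewrite mxE mbl mkl.
Qed.

(** The kernel vector is row [m] of [g], supported on [m <= k < l]. It kills the squares of the new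
    vectors [b >= m], because these only involve old vectors of index at least [m], whose products
    have no coordinate [m]. *)
Lemma square_mx_singular (m l : 'I_n) g h w :
  (m < l)%N -> h *m g = 1%:M -> star_alg w -> upper_unitri g ->
  (forall a b : 'I_n, (a < b)%N -> g a b != 0 -> (m < a)%N || (a == m) && (b < l)%N) ->
  \det (square_mx m l (act2 g h w)) = 0.
Proof.
move=> ltml hg [_ wS] uniG gP; apply/eqP/det0P.
have g0 (a b : 'I_n) : (m <= b)%N -> (a < m)%N -> g a b = 0.
  move=> lemb ltam; apply/eqP; apply: contraT => /(gP _ _ (leq_trans ltam lemb)).
  by rewrite -val_eqE /= ltn_eqF // ltnNge ltnW.
exists (\row_k if (m <= k < l)%N then g m k else 0).
  apply/rV0Pn; exists m; rewrite mxE leqnn ltml uniG // eqxx; exact: oner_neq0.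
apply/rowP => b; rewrite !mxE.
case mbl: (m <= b < l)%N; last first.
  rewrite (bigD1 b) //= !mxE mbl mul0r add0r big1 // => k /negbTE kb.
  by rewrite !mxE mbl kb mulr0.
transitivity (\sum_k g m k * act2 g h w b b k).
  apply: eq_bigr => k _; rewrite !mxE mbl; case mkl: (m <= k < l)%N => //.
  rewrite mul0r; move/negbT: mkl; rewrite negb_and -ltnNge -leqNgt => /orP[ltkm|lelk].
    by rewrite uniG 1?ltnW // -val_eqE /= gtn_eqF // mul0r.
  suff -> : g m k = 0 by rewrite mul0r.
  apply/eqP; apply: contraT => /(gP _ _ (leq_trans ltml lelk)).
  by rewrite ltnn eqxx /= ltnNge lelk.
rewrite act2_mul // big1 // => a _; rewrite big1 // => a' _.
have [ltam|lema] := ltnP a m; first by rewrite g0 ?mul0r //; case/andP: mbl.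
by rewrite wS ?mulr0 // leq_max lema.
Qed.

(** Here [g] is the identity plus the entry [(m, l)], and squaring shifts the old basis vectors
    before [l]. As the old [e_l] is [e'_l - e'_m] in the new basis, the block is a cyclic
    permutation matrix up to one sign. *)
Lemma square_mx_regular (m l : 'I_n) g h w :
  (m < l)%N -> h *m g = 1%:M ->
  (forall a b : 'I_n, g a b = (a == b)%:R + ((a == m) && (b == l))%:R) ->
  (forall b k : 'I_n, (b < l)%N -> w b b k = (k == b.+1 :> nat)%:R) ->
  \det (square_mx m l (act2 g h w)) != 0.
Proof.
move=> ltml hg gE wE; apply/negP => /det0P[v v0 vM].
have gcol (b a : 'I_n) : (b < l)%N -> g a b = (a == b)%:R.
  by move=> ltbl; rewrite gE -[b == l]val_eqE /= (ltn_eqF ltbl) andbF addr0.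
have cE (b q : 'I_n) : (m <= b < l)%N -> act2 g h w b b q =
    (q == b.+1 :> nat)%:R - ((q == m) && (l == b.+1 :> nat))%:R.
  move=> /andP[lemb ltbl].
  have Sq q' : \sum_k g q' k * act2 g h w b b k = (q' == b.+1 :> nat)%:R.
    rewrite act2_mul // (bigD1 b) //= [X in _ + X]big1 ?addr0 => [|a /negbTE ab].
      rewrite (bigD1 b) //= [X in _ + X]big1 ?addr0 => [|a /negbTE ab].
        by rewrite gcol // eqxx !mul1r wE.
      by rewrite (gcol b a) // ab mulr0 mul0r.
    by rewrite big1 // => a' _; rewrite (gcol b a) // ab !mul0r.
  have gsum q' : \sum_k g q' k * act2 g h w b b k =
      act2 g h w b b q' + (q' == m)%:R * act2 g h w b b l.
    under eq_bigr do rewrite gE mulrDl.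
    rewrite big_split /=; congr (_ + _).
      rewrite (bigD1 q') //= eqxx mul1r big1 ?addr0 // => k /negbTE qk.
      by rewrite eq_sym qk mul0r.
    rewrite (bigD1 l) //= eqxx andbT big1 ?addr0 // => k /negbTE kl.
    by rewrite kl andbF mul0r.
  have lm : (l == m) = false by rewrite -val_eqE /= gtn_eqF.
  have cl : act2 g h w b b l = (l == b.+1 :> nat)%:R.
    by have := gsum l; rewrite Sq lm mul0r addr0.
  have := gsum q; rewrite Sq cl => ->.
  by case: (q == m); rewrite ?mul1r ?mul0r ?addrK ?subr0 ?addr0.
suff v_0 : v = 0 by rewrite v_0 eqxx in v0.
apply/rowP => q; rewrite [RHS]mxE.
have vb (b : 'I_n) : \sum_k v 0 k * square_mx m l (act2 g h w) k b = 0.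
  by move/rowP/(_ b): vM; rewrite !mxE.
have [mql|] := boolP (m <= q < l)%N; last first.
  move/negbTE => mql; have := vb q; rewrite (bigD1 q) //= mxE mql eqxx mulr1.
  by rewrite big1 ?addr0 // => k /negbTE kq; rewrite mxE mql kq mulr0.
(* Column [l - 1] has its only entry in row [m] and gives [v_m = 0]; for [q > m], column [q - 1]
   gives [v_q = 0]. *)
have [qm|mq] := eqVneq q m.
  have lb : (l.-1 < n)%N by apply: leq_ltn_trans (ltn_ord l); apply: leq_pred.
  pose b := Ordinal lb; have mbl : (m <= b < l)%N by rewrite /b /=; lia.
  have := vb b; rewrite (bigD1 q) //= mxE mbl mql cE // qm eqxx.
  have -> : (l == b.+1 :> nat) by rewrite /b /=; lia.
  have -> : (m == b.+1 :> nat) = false by rewrite /b /=; lia.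
  rewrite big1 ?addr0 => [|k /negbTE km]; last first.
    rewrite mxE mbl; case mkl: (m <= k < l)%N; last by rewrite mulr0.
    rewrite cE //; have -> : (k == b.+1 :> nat) = false by rewrite /b /=; move: mkl; lia.
    by rewrite km subrr mulr0.
  by rewrite sub0r mulrN1 => /eqP; rewrite oppr_eq0 => /eqP.
have mq' : (m < q)%N by case/andP: mql => lemq _; rewrite ltn_neqAle lemq andbT eq_sym.
have qb : (q.-1 < n)%N by apply: leq_ltn_trans (ltn_ord q); apply: leq_pred.
pose b := Ordinal qb; have mbl : (m <= b < l)%N by rewrite /b /=; move: mql; lia.
have := vb b; rewrite (bigD1 q) //= mxE mbl mql cE // (negbTE mq) subr0.
have -> : (q == b.+1 :> nat) by rewrite /b /=; lia.
rewrite mulr1 big1 ?addr0 // => k /negbTE kq.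
rewrite mxE mbl; case mkl: (m <= k < l)%N; last by rewrite mulr0.
rewrite cE //.
have -> : (l == b.+1 :> nat) = false by rewrite /b /=; move: mql; lia.
have -> : (k == b.+1 :> nat) = false.
  by rewrite /b /= prednK ?(leq_ltn_trans _ mq') // val_eqE.
by rewrite andbF subrr mulr0.
Qed.

End StarParametrization.

(** * The dimension of the variety *)

Section Dimension.
Variables (F : closedFieldType) (n : nat).
Implicit Types (v : star_coord n) (x : star_coord n -> F).

Lemma xval_support x (K : nat) u :
  (forall v, x v != 0 -> (star_key v < K)%N) -> xval x u != 0 -> (raw_key u < K)%N.
Proof.
by move=> xK; rewrite /xval; case: insubP => [v _ <- /xK //|_ /=]; rewrite eqxx.
Qed.

Lemma star_param_gmx1 x : gmx x = 1%:M -> star_param x = wsc x.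
Proof.
move=> g1; rewrite /star_param g1 (@adj_inverse _ _ _ 1%:M) ?mulmx1 //.
by rewrite det1 scale1r act2_1.
Qed.

Lemma gmx1 x : (forall a b, xval x (inl (a, b)) = 0) -> gmx x = 1%:M.
Proof. by move=> x0; apply/matrixP => a b; rewrite !mxE x0; case: eqP. Qed.

(** For an entry of the matrix, the order of the keys provides the hypothesis of
    [square_mx_singular]; for a structure constant, it forces the matrix to be the identity. *)
Lemma star_fun_vanish v x :
  (forall v', x v' != 0 -> (star_key v' < star_key v)%N) ->
  star_fun v (star_param x) = 0.
Proof.
case: v => u uv x_supp; rewrite /star_fun /=.
case: u uv x_supp => [[m l]|[[i j] k]] /= uv x_supp.
  apply: square_mx_singular (gmx_adj x) (wsc_star x) (gmx_unitri x) _ => //.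
  move=> a b ltab; rewrite mxE -val_eqE /= (ltn_eqF ltab).
  move/(xval_support x_supp); rewrite /star_key /= ltn_add2l => key_lt.
  have [//|ltam|/val_inj ma] := ltngtP m a; last first.
    by move: key_lt; rewrite ma eqxx ltn_add2l.
  have := leq_mul (leq_sub2l n ltam) (leqnn n).
  have := ltn_ord m; have := ltn_ord l; nia.
have g1 : gmx x = 1%:M.
  apply: gmx1 => a b; apply/eqP; apply: contraT => /(xval_support x_supp).
  rewrite /star_key /= ltnNge => /negP[].
  by apply: leq_trans (leq_addr _ _); apply: ltnW (ltn_ord _).
rewrite star_param_gmx1 // /wsc; case/andP: (uv) => -> _.
by apply/eqP; apply: contraT => /(xval_support x_supp); rewrite ltnn.
Qed.

Lemma star_fun_separate v : exists2 x : star_coord n -> F,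
  (forall v', x v' != 0 -> (star_key v' <= star_key v)%N) &
  star_fun v (star_param x) != 0.
Proof.
case: v => u uv; rewrite /star_fun /=.
case: u uv => [[m l]|[[i j] k]] /= uv; last first.
  pose t : coord_raw n := inr (i, j, k); pose y (u : coord_raw n) : F := (u == t)%:R.
  exists (fun v' => y (val v')) => [v'|].
    by rewrite /y /star_key; have [->//|_] := eqVneq (val v') t; rewrite eqxx.
  rewrite star_param_gmx1 => [|]; last first.
    by apply: gmx1 => a b; rewrite xval_comp /=; case: ifP.
  rewrite /wsc xval_comp; case/andP: (uv) => -> _ /=.
  by rewrite uv /y eqxx oner_neq0.
(* The data of [square_mx_regular]; the structure constants it sets have smaller keys than any entry
   of the matrix, so they are allowed. *)
pose y (u : coord_raw n) : F := match u with
  | inl (a, b) => ((a == m) && (b == l))%:R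
  | inr (i, j, k) => ((i == j) && (k == j.+1 :> nat))%:R end.
exists (fun v' => y (val v')) => [[u' uv']|].
  rewrite /star_key /=; case: u' {uv'} => [[a b]|t] /=.
    by case: andP => [[/eqP-> /eqP->]//|_]; rewrite eqxx.
  by move=> _; apply: leq_trans (leq_addr _ _); apply: ltnW (ltn_ord _).
apply: square_mx_regular (gmx_adj _) _ _ => // [a b|b k _].
  rewrite mxE xval_comp /=; have [->|ab] := eqVneq a b.
    have [->|] := eqVneq b m; last by rewrite addr0.
    by rewrite -val_eqE /= ltn_eqF // addr0.
  rewrite add0r; case: ltnP => // leba; case: andP => // -[/eqP am /eqP bl].
  by move: uv; rewrite -am -bl ltnNge leba.
rewrite /wsc leqnn xval_comp /= leqnn eqxx /=.
by have [//|leb] := ltnP b k; rewrite ltn_eqF // ltnS.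
Qed.

Lemma comm_nilp_zdim :
  zdim_eq (@comm_nilp F n) (n * (n - 1) * (n + 4) %/ 6)%N.
Proof.
rewrite -card_coord; split; last first.
  apply: (param_chain_bound (phi := @star_param n F)) => [|c].
    exact: star_param_poly.
  exact: (iffLR (comm_nilp_star_param _)).
apply: (@param_has_chain _ _ _ _ (@star_param_poly n F) _ (@star_key n) (@star_fun F n)).
- by move=> c; apply: (iffRL (comm_nilp_star_param _)).
- exact: star_key_inj.
- exact: star_fun_poly.
- exact: star_fun_vanish.
- exact: star_fun_separate.
Qed.

End Dimension.

(** * Normal form of a generic algebra *)

Section NormalForm.
Variable F : closedFieldType.
Variable W : nat -> nat -> nat -> F.
Hypothesis WC : forall i j k, W i j k = W j i k.
Implicit Types x y : nat -> F.

(** The sums stop below [k] because under [condStar] the other terms vanish. *)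
Definition mulW x y : nat -> F :=
  fun k => \sum_(i < k) \sum_(j < k) x i * y j * W i j k.

Lemma mulW_low x y j k : (forall b, (b < j)%N -> y b = 0) -> (k <= j)%N ->
  mulW x y k = 0.
Proof.
move=> y0 lekj; rewrite /mulW big1 // => a _; rewrite big1 // => b _.
by rewrite y0 ?mulr0 ?mul0r // (leq_trans (ltn_ord b)).
Qed.

(** This turns the condition on [c_1i^(i+1)] into a linear equation in the coordinates of the first
    basis vector. *)
Lemma mulW_lead x y j : (forall b, (b < j)%N -> y b = 0) ->
  mulW x y j.+1 = y j * \sum_(a < j.+1) x a * W a j j.+1.
Proof.
move=> y0; rewrite /mulW mulr_sumr; apply: eq_bigr => a _.
rewrite big_ord_recr big1 /= => [|b _]; first by rewrite add0r; ring.
by rewrite y0 ?mulr0 ?mul0r.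
Qed.

Lemma triangular_solution (M : nat -> nat -> F) tau N : exists x, x 0%N = tau /\
  forall i, (0 < i < N)%N -> M i i != 0 -> \sum_(j < i.+1) x j * M j i = 0.
Proof.
elim: N => [|N [x [x0 xM]]]; first by exists (fun=> tau); split=> // i; rewrite andbF.
case: (posnP N) => [->|N_gt0].
  by exists (fun=> tau); split=> // i; lia.
pose z j := if j == N then - (\sum_(i < N) x i * M i N) / M N N else x j.
have zx i : (i < N)%N -> z i = x i by move=> ltiN; rewrite /z ltn_eqF.
exists z; split=> [|i /andP[i_gt0]]; first by rewrite zx.
rewrite ltnS leq_eqVlt => /orP[/eqP-> MN|ltiN Mi]; last first.
  rewrite -[RHS](xM i) ?i_gt0 //; apply: eq_bigr => j _.
  by rewrite zx // (leq_trans (ltn_ord j)).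
rewrite big_ord_recr /= {2}/z eqxx divfK //.
under eq_bigr do rewrite zx //.
exact: subrr.
Qed.

Lemma closed_sqrt (a : F) : exists b, b ^+ 2 = a.
Proof.
have /closed_rootP[b] : size ('X^2 - a%:P) != 1%N by rewrite size_XnsubC.
by rewrite /root !hornerE subr_eq0 => /eqP; exists b.
Qed.

(* The numerators of the constants c_23^4 and c_12^4 (indices from 1) after normalisation
   of the c_ii^(i+1) and c_1i^(i+1). *)
Definition generic_cond1 :=
  W 0 0 1 * W 1 1 2 * W 1 2 3 + (W 0 0 2 * W 1 1 2 - W 0 1 2 ^+ 2) * W 2 2 3.

Definition generic_cond2 :=
  W 0 1 3 * W 1 1 2 * W 2 2 3 - W 0 1 2 * W 1 1 3 * W 2 2 3
  - (W 0 2 3 * W 1 1 2 - W 0 1 2 * W 1 2 3) * W 1 2 3.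

(** Everything is determined by [e 0], each vector being the square of the previous one. The
    conditions on the products of [e 0] with [e i] form a triangular linear system in the
    coordinates of [e 0]; its first coordinate [tau] stays free until the last normalisation. *)
Lemma normal_basis N : (4 <= N)%N ->
  (forall i, (i.+1 < N)%N -> W i i i.+1 != 0) ->
  generic_cond1 != 0 -> generic_cond2 != 0 ->
  exists e : nat -> nat -> F,
    [/\ (forall i k, (k < i)%N -> e i k = 0),
        (forall i, (i < N)%N -> e i i != 0),
        (forall i, e i.+1 = mulW (e i) (e i)),
        (forall i k, (0 < i)%N -> (i.+1 < N)%N -> (k <= i.+1)%N ->
           mulW (e 0%N) (e i) k = 0) &
        mulW (e 1%N) (e 2%N) 3 = e 3%N 3%N /\ mulW (e 0%N) (e 1%N) 3 != 0].
Proof.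
move=> N_ge4 d_neq0 cond1 cond2.
have d0 := d_neq0 0%N (leq_trans (isT : 2 <= 4)%N N_ge4).
have d1 := d_neq0 1%N (leq_trans (isT : 3 <= 4)%N N_ge4).
have d2 := d_neq0 2%N N_ge4.
(* In [mulW (e 1) (e 2) 3 = e 3 3] the left side has degree 6 in [tau] and the right side degree 8,
   so [tau ^ 2] is prescribed. *)
have [tau tau2] := closed_sqrt (generic_cond1 / (W 0 0 1 ^+ 2 * W 1 1 2 ^+ 2 * W 2 2 3)).
have tau_neq0 : tau != 0.
  by rewrite -sqrf_eq0 tau2 mulf_neq0 // invr_eq0 !mulf_neq0 ?expf_neq0.
have [x [x0 xM]] := triangular_solution (fun j i => W j i i.+1) tau N.-1.
pose e i := iter i (fun y => mulW y y) x.
have eS i : e i.+1 = mulW (e i) (e i) by [].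
have e_low i k : (k < i)%N -> e i k = 0.
  elim: i k => [//|i IHi] k; rewrite ltnS eS; exact: mulW_low.
have e_lead i : e i.+1 i.+1 = e i i ^+ 2 * W i i i.+1.
  rewrite eS (mulW_lead _ (e_low i)) big_ord_recr big1 /= => [|a _].
    by rewrite add0r mulrA.
  by rewrite e_low // mul0r.
have e_diag i : (i < N)%N -> e i i != 0.
  elim: i => [_|i IHi ltiN]; first by rewrite /= x0.
  by rewrite e_lead mulf_neq0 ?d_neq0 // expf_neq0 // IHi // ltnW.
have e0_mul i k : (0 < i)%N -> (i.+1 < N)%N -> (k <= i.+1)%N ->
    mulW (e 0%N) (e i) k = 0.
  move=> i_gt0 ltiN; rewrite leq_eqVlt => /orP[/eqP->|ltki]; last exact: mulW_low _ (e_low i) _.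
  rewrite (mulW_lead _ (e_low i)) xM ?mulr0 // ?i_gt0 //=; first by lia.
  exact: d_neq0.
have e0 : e 0%N = x by [].
exists e; split=> //; clearbody e.
have := xM 1%N; have := xM 2%N; rewrite !big_ord_recl !big_ord0 /= /bump /= !add1n.
move=> /(_ _ d2) E2 /(_ _ d1) E1.
have {}E1 : x 1%N = - tau * W 0 1 2 / W 1 1 2.
  have /eqP : x 0%N * W 0 1 2 + (x 1%N * W 1 1 2 + 0) = 0 by apply: E1; lia.
  by rewrite addr0 addrC addr_eq0 x0 => /eqP E; rewrite -[LHS](mulfK d1) E !mulNr.
have {}E2 : x 2%N = - (tau * W 0 2 3 + x 1%N * W 1 2 3) / W 2 2 3.
  have /eqP : x 0%N * W 0 2 3 + (x 1%N * W 1 2 3 + (x 2%N * W 2 2 3 + 0)) = 0.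
    by apply: E2; lia.
  by rewrite addr0 addrA addrC addr_eq0 x0 => /eqP E; rewrite -[LHS](mulfK d2) E.
have e11 : e 1%N 1%N = tau ^+ 2 * W 0 0 1 by rewrite e_lead e0 x0.
have e12 : e 1%N 2%N = tau ^+ 2 * (W 0 0 2 - W 0 1 2 ^+ 2 / W 1 1 2).
  rewrite eS e0 /mulW !big_ord_recl !big_ord0 /= /bump /= !add1n x0 E1 (WC 1 0).
  by field.
have cond_tau : tau ^+ 2 * (W 0 0 1 ^+ 2 * W 1 1 2 ^+ 2 * W 2 2 3) = generic_cond1.
  by rewrite tau2 divfK // !mulf_neq0 ?expf_neq0.
split.
  rewrite (mulW_lead _ (e_low 2%N)) (e_lead 2%N) expr2 -mulrA; congr (_ * _).
  rewrite !big_ord_recl big_ord0 /= /bump /= !add1n (e_low 1%N 0%N) // e11 e12.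
  rewrite (e_lead 1%N) e11; apply: (mulfI d1).
  transitivity (tau ^+ 2 * generic_cond1); first by rewrite /generic_cond1; field.
  by rewrite -cond_tau; ring.
rewrite e0 /mulW !big_ord_recl !big_ord0 /= /bump /= !add1n.
rewrite (e_low 1%N 0%N) // e11 x0 E2 (WC 1 0) (WC 2 0) (WC 2 1).
(* The coefficient of [mu] is the equation that defines [x 2], so [mu] cancels. *)
set mu := e 1%N 2%N.
have : tau ^+ 3 * W 0 0 1 * generic_cond2 / (W 1 1 2 * W 2 2 3) != 0.
  by rewrite !mulf_neq0 ?invr_eq0 ?mulf_neq0 ?expf_neq0.
by congr (_ != 0); rewrite /generic_cond2 E1; field; rewrite d1 d2.
Qed.
End NormalForm.

(** * Density of the family *)

Section FamilyS.
Variables (F : closedFieldType) (n : nat).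
Implicit Types (w : sconst F n) (g h : 'M[F]_n).

(* Zero outside the range of the indices. *)
Definition wext w (i j k : nat) : F :=
  if insub i is Some i' then if insub j is Some j' then
    if insub k is Some k' then w i' j' k' else 0 else 0 else 0.

Lemma wext_ord w (i j k : 'I_n) : wext w i j k = w i j k.
Proof. by rewrite /wext !valK. Qed.

Lemma wextC w i j k : commutative_sc w -> wext w i j k = wext w j i k.
Proof.
move=> wC; rewrite /wext; case: insub => [i'|]; case: insub => [j'|] //.
by case: insub => // k'; apply: wC.
Qed.

Lemma wext_fun (f : nat -> nat -> nat -> F) i j k :
  (i < n)%N -> (j < n)%N -> (k < n)%N ->
  wext (fun i' j' k' : 'I_n => f i' j' k') i j k = f i j k.
Proof. by move=> ltin ltjn ltkn; rewrite /wext !insubT. Qed.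

Lemma fr_wext (X : Type) (P : (X -> F) -> Prop) (c : X -> sconst F n) i j k :
  function_ring P -> (forall i j k, P (fun x => c x i j k)) ->
  P (fun x => wext (c x) i j k).
Proof.
move=> ringP Pc; rewrite /wext; case: insub => [i'|]; last exact: fr_cst.
by case: insub => [j'|]; [case: insub => [k'|]|]; try exact: fr_cst.
Qed.

(** In use, [v] holds the coordinates of a product in the old basis and [c] those in the new one:
    leading zeros pass from [v] to [c], and the next terms differ by a diagonal entry of [g]. *)
Lemma forward_substitution g (c v : 'I_n -> F) (K : nat) :
  is_trig_mx g -> (forall i, g i i != 0) ->
  (forall m, \sum_k g m k * c k = v m) -> (forall m : 'I_n, (m < K)%N -> v m = 0) ->
  (forall k : 'I_n, (k < K)%N -> c k = 0) /\
  (forall k : 'I_n, k = K :> nat -> g k k * c k = v k).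
Proof.
move=> /is_trig_mxP g_trig g_diag gc v0.
have step (m : 'I_n) : (forall k : 'I_n, (k < m)%N -> c k = 0) -> g m m * c m = v m.
  move=> c0; rewrite -gc (bigD1 m) //= big1 ?addr0 // => k km.
  case: (ltngtP k m) => [/c0->|ltmk|/val_inj kE]; first by rewrite mulr0.
    by rewrite g_trig ?mul0r.
  by rewrite kE eqxx in km.
have c0 N (k : 'I_n) : (k < N)%N -> (k < K)%N -> c k = 0.
  elim: N k => [//|N IHN] k ltkN ltkK; apply: (mulfI (g_diag k)).
  rewrite mulr0 step ?v0 // => l ltlk.
  by apply: IHN; [apply: leq_trans ltlk _ | apply: ltn_trans ltlk _].
split=> [k|k kK]; first exact: c0.
by apply: step => l ltlk; apply: (c0 l.+1); rewrite // -kK.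
Qed.

Lemma normal_form w : (4 <= n)%N -> star_alg w ->
  (forall i, (i.+1 < n)%N -> wext w i i i.+1 != 0) ->
  generic_cond1 (wext w) != 0 -> generic_cond2 (wext w) != 0 ->
  exists g h, h *m g = 1%:M /\ familyS (act2 g h w).
Proof.
move=> n_ge4 wS d_neq0 cond1 cond2; have [wC wstar] := wS.
have [e [e_low e_diag eS e0_mul [e12 e01]]] :=
  normal_basis (fun i j k => wextC i j k wC) n_ge4 d_neq0 cond1 cond2.
pose g : 'M[F]_n := \matrix_(a, i) e i a.
have g_trig : is_trig_mx g by apply/is_trig_mxP => a i ltai; rewrite mxE e_low.
have g_diag i : g i i != 0 by rewrite mxE e_diag.
have g_unit : g \in unitmx.
  by rewrite unitmxE unitfE det_trig //; apply/prodf_neq0 => i _.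
have hg : invmx g *m g = 1%:M by rewrite mulVmx.
exists g, (invmx g); split=> //; set c := act2 g (invmx g) w.
have gc i j m : \sum_k g m k * c i j k = mulW (wext w) (e i) (e j) m.
  have widen (G : nat -> F) : (forall a : 'I_n, (m <= a)%N -> G a = 0) ->
      \sum_(a < n) G a = \sum_(a < m) G a.
    move=> G0; rewrite (big_ord_widen n G (ltnW (ltn_ord m))) [RHS]big_mkcond.
    by apply: eq_bigr => a _; case: ltnP => // /G0.
  rewrite act2_mul // /mulW.
  rewrite -(widen (fun a => \sum_(b < m) e i a * e j b * wext w a b m)) => [|a lema].
    apply: eq_bigr => a _.
    rewrite -(widen (fun b => e i a * e j b * wext w a b m)) => [|b lemb].
      by apply: eq_bigr => b _; rewrite !mxE wext_ord.
    by rewrite wext_ord wstar ?mulr0 // leq_max lemb orbT.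
  rewrite big1 // => b _; have ltbn := ltn_trans (ltn_ord b) (ltn_ord m).
  rewrite (wext_ord _ a (Ordinal ltbn)) wstar ?mulr0 // leq_max lema //.
have cC : commutative_sc c by apply: commutative_act2.
have subst i j K := forward_substitution (K := K) g_trig g_diag (gc i j).
split=> //; split.
  move=> i j k; have c0 (i' j' : 'I_n) : (k <= j')%N -> c i' j' k = 0.
    move=> lekj; apply: (subst i' j' j'.+1 _).1 => // m.
    by rewrite ltnS; apply: mulW_low => b; apply: e_low.
  by rewrite leq_max => /orP[/c0|/c0//]; rewrite cC.
split.
  move=> i k ltin; pose si := Ordinal ltin.
  apply/eqP; rewrite -subr_eq0; apply/eqP.
  (* All coordinates of the square matter here, not only the leading one, hence [K = n] and the
     difference with a unit vector. *)
  apply: (forward_substitution (K := n) (v := fun=> 0)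
    (c := fun k => c i i k - (k == si)%:R) g_trig g_diag _ _).1 => // m.
  under eq_bigr do rewrite mulrBr.
  rewrite sumrB gc -eS (bigD1 si) //= eqxx mulr1 big1 => [|l /negbTE->].
    by rewrite addr0 mxE subrr.
  by rewrite mulr0.
split.
  move=> i j k i1 j2 k3; apply: (mulfI (g_diag k)); rewrite mulr1.
  rewrite ((subst i j 3%N _).2 k k3) => [|m ltm3].
    by rewrite i1 j2 k3 e12 mxE k3.
  by rewrite j2; apply: (@mulW_low _ _ _ _ 2%N) => // b; apply: e_low.
split.
  move=> i j k i0 j1 k3; suff : g k k * c i j k != 0 by rewrite mulf_eq0 negb_or => /andP[].
  rewrite ((subst i j 3%N _).2 k k3) => [|m ltm3]; first by rewrite i0 j1 k3.
  by rewrite i0 j1 e0_mul //; apply: leq_trans n_ge4.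
move=> i j k i0 j1 kj; apply: (subst i j j.+2 _).1 => [m ltm|].
  by rewrite i0 e0_mul // -kj.
by rewrite kj.
Qed.

Lemma familyS_star (c : sconst F n) : familyS c -> star_alg c.
Proof. by move=> [cC [cS _]]. Qed.

(** A test point: [e_i^2 = e_(i+1)] and [e_2 e_3 = e_1 e_2 = e_4], counting from 1, chosen so that
    every genericity condition takes the value 1. *)
Definition model_coef (i j k : nat) : bool :=
  [|| (i == j) && (k == i.+1), (k == 3%N) && ((i, j) \in [:: (1, 2); (2, 1)]%N)
    | (k == 3%N) && ((i, j) \in [:: (0, 1); (1, 0)]%N)].

Definition model : sconst F n := fun i j k => (model_coef i j k)%:R.

Lemma model_star : star_alg model.
Proof.
split=> [i j k|i j k lek]; rewrite /model; last first.
  suff -> : model_coef i j k = false by [].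
  rewrite /model_coef !inE !xpair_eqE; move: lek; lia.
congr (_%:R); congr nat_of_bool; rewrite /model_coef !inE !xpair_eqE.
by apply/idP/idP; lia.
Qed.

Definition generic_cond w : F :=
  (\prod_(i < n.-1) wext w i i i.+1) * generic_cond1 (wext w) * generic_cond2 (wext w).

Lemma generic_cond_poly (c : F -> sconst F n) :
  (forall i j k, poly_curve (fun t => c t i j k)) ->
  poly_curve (fun t => generic_cond (c t)).
Proof.
move=> Pc; have ringP := @poly_curve_ring F.
have Pe i j k := fr_wext i j k ringP Pc.
have Pd : poly_curve (fun t => \prod_(i < n.-1) wext (c t) i i i.+1).
  exact: (fr_prod ringP _ (f := fun (i : 'I_n.-1) t => wext (c t) i i i.+1)).
rewrite /generic_cond /generic_cond1 /generic_cond2.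
by do !first [exact: Pe | exact: Pd | apply: (fr_exp ringP)
  | apply: (fr_opp ringP) | apply: (fr_mul ringP) | apply: (fr_add ringP)].
Qed.

Lemma model_cond : (4 <= n)%N -> generic_cond model = 1.
Proof.
move=> n_ge4; have wE i j k : (i < n)%N -> (j < n)%N -> (k < n)%N ->
    wext model i j k = (model_coef i j k)%:R.
  exact: (wext_fun (fun i j k => (model_coef i j k)%:R)).
rewrite /generic_cond big1 => [|i _]; last first.
  have ltin := ltn_ord i; rewrite wE; [by rewrite /model_coef !eqxx | lia..].
rewrite /generic_cond1 /generic_cond2 !wE ?(leq_trans _ n_ge4) //.
by rewrite /model_coef /=; ring.
Qed.

Lemma generic_condP w : generic_cond w != 0 ->
  [/\ forall i, (i.+1 < n)%N -> wext w i i i.+1 != 0,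
      generic_cond1 (wext w) != 0 & generic_cond2 (wext w) != 0].
Proof.
rewrite /generic_cond !mulf_eq0 !negb_or => /andP[/andP[/prodf_neq0 d_neq0 -> ->]].
split=> // i ltin; have ltin' : (i < n.-1)%N by case: (n) ltin.
exact: (d_neq0 (Ordinal ltin')).
Qed.

(** On the line from [w] to [model], every point off the zeros of [generic_cond] is isomorphic to a
    member of the family. A polynomial vanishing on the orbits of the family therefore vanishes
    along the whole line moved by [g], in particular at its origin. *)
Lemma familyS_generic : (4 <= n)%N -> generic (@familyS F n) (@comm_nilp F n).
Proof.
move=> n_ge4 c; split.
  apply: zclosure_sub; first exact: zclosed_comm_nilp.
  move=> {}c [a /familyS_star aS [g g_unit cE]]; apply/comm_nilpP.
  exists g, (invmx g), a; split=> //; first exact: mulVmx.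
  exact: sconst_eqP.
case/comm_nilpP => [g [h [w [hg wS ->]]]].
apply/mem_zclosureP => p Pp p0; have ringP := @poly_curve_ring F.
pose wt t : sconst F n := fun i j k => (1 - t) * w i j k + t * model i j k.
have wtS t : star_alg (wt t).
  have [[wC wS'] [mC mS]] := (wS, model_star).
  split=> i j k => [|lek]; rewrite /wt; first by rewrite wC mC.
  by rewrite wS' // mS // !mulr0 addr0.
have wt_poly i j k : poly_curve (fun t => wt t i j k) by apply: poly_curve_line.
have wt0 : wt 0 = w by apply: sconst_eqP => i j k; rewrite /wt subr0 mul1r mul0r addr0.
have wt1 : wt 1 = model.
  by apply: sconst_eqP => i j k; rewrite /wt subrr mul0r mul1r add0r.
suff pw t : p (act2 g h (wt t)) = 0 by rewrite -wt0.
move: t; apply: (@poly_curve_eq0 _ (fun t => p (act2 g h (wt t)))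
  (fun t => generic_cond (wt t)) 1).
- apply: (fr_polyfun ringP) Pp.
  by apply: (fr_act2 ringP) => // i j; apply: (fr_cst ringP).
- exact: generic_cond_poly.
- by rewrite wt1 model_cond // oner_neq0.
move=> t /generic_condP[d_neq0 cond1 cond2]; apply: p0.
have [g' [h' [h'g' Ss]]] := normal_form n_ge4 (wtS t) d_neq0 cond1 cond2.
exists (act2 g' h' (wt t)) => //.
(* From the normal form back to [act2 g h (wt t)]: undo [g'], then apply [g]. *)
have hg' : (h *m g') *m (h' *m g) = 1%:M.
  by rewrite mulmxA -(mulmxA h) (mulmx1C h'g') mulmx1.
exists (h' *m g) => [|i j k]; first by have [] := mulmx1_unit hg'.
by rewrite (actE _ hg') act2_comp mulmxA (mulmx1C h'g') mul1mx -mulmxA (mulmx1C h'g') mulmx1.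
Qed.

End FamilyS.

Theorem theoremB (R : realType) :
  (forall n : nat, (4 <= n)%N ->
     generic (@familyS R[i] n) (@comm_nilp R[i] n)) /\
  (forall n : nat, (2 <= n)%N ->
     zclosed (@comm_nilp R[i] n) /\
     irreducible (@comm_nilp R[i] n) /\
     zdim_eq (@comm_nilp R[i] n) (n * (n - 1) * (n + 4) %/ 6)%N).
Proof.
split=> n n_ge; first exact: familyS_generic.
split; first exact: zclosed_comm_nilp.
by split; [exact: irreducible_comm_nilp | exact: comm_nilp_zdim].
Qed.
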